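(* Assume $\rho=\rho_n\in(0,1/2)$ with $\rho=o(1)$, $p_\ell\asymp q_\ell=o(1)$ for all $\ell\in[L]$, and $L\le C_0 n^{c}$ for some constants $c\ge0$, $C_0>0$. Fix any $\beta\ge 1$ and write $\mathcal P_n=\mathcal P_n(\rho,\{p_\ell\}_1^L,\{q_\ell\}_1^L,\beta)$. (i) If $\min_{S\subseteq[L]}\mathcal I_S\to\infty$, then there exists a sequence $\underline\delta_n=o(1)$ such that $$\inf_{\hat{\mathbf z}^\star}\sup_{\mathbf z^\star\in\mathcal P_n}\mathbb E\,\mathcal L(\hat{\mathbf z}^\star,\mathbf z^\star)\ \ge\ \exp\Big\{-(1+\underline\delta_n)\min_{S\subseteq[L]}\mathcal I_S\Big\}.$$ (ii) If $\min_{S\subseteq[L]}\mathcal I_S=O(1)$, then there is a constant $c'>0$ with $\inf_{\hat{\mathbf z}^\star}\sup_{\mathbf z^\star\in\mathcal P_n}\mathbb E\,\mathcal L(\hat{\mathbf z}^\star,\mathbf z^\star)\ge c'$ for all large $n$. Here the infimum is over all estimators $\hat{\mathbf z}^\star\in\{\pm1\}^n$ that are measurable functions of the observed $\{A^{(\ell)}\}_{\ell=1}^L$.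
   Context: Inhomogeneous multilayer SBM (IMLSBM). Fix integers $n,L\ge1$, a global label vector $\mathbf z^\star\in\{\pm1\}^n$, $\rho\in[0,1/2]$, and $0<q_\ell<p_\ell<1$ for $\ell\in[L]$. Individual label vectors $\mathbf z^{(1)},\dots,\mathbf z^{(L)}\in\{\pm1\}^n$ are generated as $\mathbf z^{(\ell)}_i=\mathbf z^\star_i\xi_{\ell i}$ with $\xi_{\ell i}$ i.i.d., $P(\xi_{\ell i}=1)=1-\rho$, $P(\xi_{\ell i}=-1)=\rho$. Given the labels, the symmetric adjacency matrices $A^{(\ell)}\in\{0,1\}^{n\times n}$ have zero diagonal and independent entries $A^{(\ell)}_{ij}=A^{(\ell)}_{ji}$ ($i<j$, $\ell\in[L]$), distributed as Bern$(p_\ell)$ if $\mathbf z^{(\ell)}_i=\mathbf z^{(\ell)}_j$ and Bern$(q_\ell)$ otherwise. Only $\{A^{(\ell)}\}$ is observed. Write $n_\pm(\mathbf z^\star)=\#\{i:\mathbf z^\star_i=\pm1\}$. For $\beta\ge1$, $\mathcal P_n(\rho,\{p_\ell\},\{q_\ell\},\beta)$ is the collection of such models with $n/(2\beta)\le n_\pm(\mathbf z^\star)\le n\beta/2$; a supremum ''over $\mathbf z^\star\in\mathcal P_n$'' is over all such $\mathbf z^\star$ with the other parameters fixed. Loss: $\mathcal L(\hat{\mathbf z},\mathbf z)=n^{-1}\min\{d_H(\hat{\mathbf z},\mathbf z),d_H(-\hat{\mathbf z},\mathbf z)\}$, $d_H$ the Hamming distance. Probabilities/expectations are over both label sampling and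 edges. All quantities may depend on $n$; asymptotics are as $n\to\infty$; ''$p_\ell\asymp q_\ell=o(1)$ for all $\ell$'' means there is a constant $C\ge1$ independent of $n,\ell$ with $q_\ell<p_\ell\le Cq_\ell$ and $\max_\ell p_\ell\to0$. Information quantities. For $\ell\in[L]$, $t\in[0,1]$: $I^{(\ell)}_t=-\log\big\{[p_\ell^{1-t}q_\ell^t+(1-p_\ell)^{1-t}(1-q_\ell)^t][p_\ell^tq_\ell^{1-t}+(1-p_\ell)^t(1-q_\ell)^{1-t}]\big\}$. For $S\subseteq[L]$: $\psi_S(t)=-\frac n2\sum_{\ell\in S}I^{(\ell)}_t$ and $\psi_S^\star(a)=\sup_{0\le t\le1}\{at-\psi_S(t)\}$. $J_\rho=-\log\big(2\sqrt{\rho(1-\rho)}\big)$. With $S^c=[L]\setminus S$: $\mathcal I_S=|S^c|J_\rho+\psi^\star_S(0)$ if $|S^c|$ is even, and $\mathcal I_S=(|S^c|+1)J_\rho+\psi_S^\star(-2J_\rho)$ if $|S^c|$ is odd.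
   Formalization: The claim is proved under the added assumption that P_n is non-empty for all large n, which forces β > 1; for β = 1 the class P_n is empty at every odd n, so the supremum is undefined there. *)

(* Defs.v *)
From HB Require Import structures.
From mathcomp Require Import all_boot all_order all_algebra.
From mathcomp Require Import all_classical all_reals all_analysis.
Set Implicit Arguments. Unset Strict Implicit. Unset Printing Implicit Defensive.
Import Order.TTheory GRing.Theory Num.Theory.
Import numFieldNormedType.Exports.
Local Open Scope classical_set_scope.
Local Open Scope ring_scope.

(* Labels in {+1,-1}^n encoded as booleans: true = +1, false = -1. *)
Definition labels (n : nat) := {ffun 'I_n -> bool}.
Definition obs (n L : nat) := {ffun 'I_L * 'I_n * 'I_n -> bool}.
(* Label noise: xi (l,i) = true  means  xi_{l i} = -1 (flip). *)
Definition noise (n L : nat) := {ffun 'I_L * 'I_n -> bool}.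

Definition bern (R : realType) (b : bool) (r : R) : R := if b then r else 1 - r.

Definition noise_prob (R : realType) (n L : nat) (rho : R) (xi : noise n L) : R :=
  \prod_(k : 'I_L * 'I_n) (if xi k then rho else 1 - rho).

(* z^{(l)}_i = zstar_i xi_{l i} *)
Definition layer_label (n L : nat) (z : labels n) (xi : noise n L)
  (l : 'I_L) (i : 'I_n) : bool := z i (+) xi (l, i).

Definition valid_adj (n L : nat) (A : obs n L) : bool :=
  [forall l : 'I_L, forall i : 'I_n, forall j : 'I_n,
      (A (l, i, j) == A (l, j, i)) && ~~ A (l, i, i)].

(* P(A | layer labels zl): independent Bernoulli entries for i<j; the
   remaining entries are determined by symmetry / zero diagonal. *)
Definition adj_prob (R : realType) (n L : nat) (p q : nat -> R)
  (zl : 'I_L -> 'I_n -> bool) (A : obs n L) : R :=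
  (valid_adj A)%:R *
  \prod_(l : 'I_L) \prod_(i : 'I_n) \prod_(j : 'I_n | (i < j)%N)
     bern (A (l, i, j)) (if zl l i == zl l j then p l else q l).

Definition hamming (n : nat) (x y : labels n) : nat := #|[set i | x i != y i]|.

Definition loss (R : realType) (n : nat) (zh z : labels n) : R :=
  (minn (hamming zh z) (hamming [ffun i => ~~ zh i] z))%:R / n%:R.

Definition risk (R : realType) (n L : nat) (rho : R) (p q : nat -> R)
  (f : obs n L -> labels n) (z : labels n) : R :=
  \sum_(xi : noise n L) noise_prob rho xi *
    \sum_(A : obs n L) adj_prob p q (layer_label z xi) A * loss R (f A) z.

Definition n_plus (n : nat) (z : labels n) : nat := #|[set i | z i]|.
Definition n_minus (n : nat) (z : labels n) : nat := #|[set i | ~~ z i]|.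

Definition in_Pn (R : realType) (n : nat) (beta : R) (z : labels n) : Prop :=
  n%:R / (2 * beta) <= (n_plus z)%:R <= n%:R * beta / 2 /\
  n%:R / (2 * beta) <= (n_minus z)%:R <= n%:R * beta / 2.

Definition minimax_risk (R : realType) (n L : nat) (rho : R) (p q : nat -> R)
  (beta : R) : R :=
  inf [set sup [set risk rho p q f z | z in [set z : labels n | in_Pn beta z]]
       | f in [set: obs n L -> labels n]].

Definition Iinfo (R : realType) (p q t : R) : R :=
  - ln ((p `^ (1 - t) * q `^ t + (1 - p) `^ (1 - t) * (1 - q) `^ t) *
        (p `^ t * q `^ (1 - t) + (1 - p) `^ t * (1 - q) `^ (1 - t))).

Definition psiS (R : realType) (n L : nat) (p q : nat -> R) (S : {set 'I_L})
  (t : R) : R :=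
  - (n%:R / 2) * \sum_(l in S) Iinfo (p l) (q l) t.

Definition psiS_star (R : realType) (n L : nat) (p q : nat -> R)
  (S : {set 'I_L}) (a : R) : R :=
  sup [set a * t - psiS n p q S t | t in `[0, 1]].

Definition Jrho (R : realType) (rho : R) : R := - ln (2 * Num.sqrt (rho * (1 - rho))).

Definition calI (R : realType) (n L : nat) (rho : R) (p q : nat -> R)
  (S : {set 'I_L}) : R :=
  let m := #|~: S| in
  if odd m then m.+1%:R * Jrho rho + psiS_star n p q S (- 2 * Jrho rho)
  else m%:R * Jrho rho + psiS_star n p q S 0.

Definition minI (R : realType) (n L : nat) (rho : R) (p q : nat -> R) : R :=
  \big[Num.min/calI n rho p q [set: 'I_L]]_(S : {set 'I_L}) calI n rho p q S.

(* Main.v *)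
(* Two label vectors differing at a single node [i] are hard to distinguish. For a set [S] of layers,
   couple the two models by sharing the label noise in the layers of [S], and by giving node [i]
   opposite flips in the layers outside [S], where half of the flips (rounded up) are switched on:
   then the labels outside [S] coincide, and given the noise the two edge laws are products of
   Bernoulli laws that differ only at the edges of [i] in [S]. Writing [P] and [Q] for them and
   [Lam] for the log-likelihood ratio, with [R ~ P^(1-t) Q^t] the exponential tilt, normalised by [Z],
     sum min(P, e^x Q) >= Z e^(t x) E_R e^(-|Lam - x|) >= Z e^(t x) exp(- E_R |Lam - x|),
   where [t] is chosen by the intermediate value theorem so that [E_R Lam = x] when all layer
   communities are balanced, and the deviations of [Lam] (edge fluctuations and imbalances caused by
   the noise) are of lower order than [calI S]. Averaging over labels that are free on a small fixed
   proportion of the nodes turns this testing bound into the minimax bound. *)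
Require Import Defs.
From HB Require Import structures.
From mathcomp Require Import all_boot all_order all_algebra.
From mathcomp Require Import all_classical all_reals all_analysis.
From mathcomp Require Import ring lra zify.
Set Implicit Arguments. Unset Strict Implicit. Unset Printing Implicit Defensive.
Import Order.TTheory GRing.Theory Num.Theory.
Import numFieldNormedType.Exports.
Local Open Scope classical_set_scope.
Local Open Scope ring_scope.

(** * Exponential tilting of product measures *)

(** Tangent line at the mean: [expR (f x) >= expR m * (1 + (f x - m))], and the weighted sum of the
    right-hand sides is [expR m]. *)
Lemma expR_jensen (R : realType) (T : finType) (w f : T -> R) :
  (forall x, 0 <= w x) -> \sum_x w x = 1 ->
  expR (\sum_x w x * f x) <= \sum_x w x * expR (f x).
Proof.
move=> w0 w1; set m := \sum_x w x * f x.
have -> : expR m = \sum_x w x * (expR m * (1 + (f x - m))).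
  transitivity (expR m * \sum_x (w x * f x + (1 - m) * w x)).
    rewrite big_split /= -mulr_sumr w1 -/m; ring.
  by rewrite mulr_sumr; apply: eq_bigr => x _; ring.
apply: ler_sum => x _; apply: ler_wpM2l => //.
have -> : expR (f x) = expR m * expR (f x - m) by rewrite -expRD; congr expR; ring.
by apply: ler_wpM2l; [exact: expR_ge0|exact: expR_ge1Dx].
Qed.

Definition prodw (R : realType) (K : finType) (w : K -> bool -> R)
  (B : {ffun K -> bool}) : R := \prod_k w k (B k).

Lemma prodw_ge0 (R : realType) (K : finType) (w : K -> bool -> R) B :
  (forall k b, 0 <= w k b) -> 0 <= prodw w B.
Proof. by move=> w0; apply: prodr_ge0. Qed.

Lemma sum_prodw (R : realType) (K : finType) (w : K -> bool -> R) :
  (forall k, \sum_b w k b = 1) -> \sum_B prodw w B = 1.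
Proof. by move=> w1; rewrite -bigA_distr_bigA big1. Qed.

Lemma sum_prodw_tilt (R : realType) (K : finType) (w g : K -> bool -> R) :
  \sum_B prodw w B * \prod_k g k (B k) = \prod_k \sum_b w k b * g k b.
Proof. by rewrite bigA_distr_bigA; apply: eq_bigr => B _; rewrite -big_split. Qed.

Lemma sum_prodw_coord (R : realType) (K : finType) (w : K -> bool -> R)
    (k0 : K) (f : bool -> R) :
  (forall k, \sum_b w k b = 1) ->
  \sum_B prodw w B * f (B k0) = \sum_b w k0 b * f b.
Proof.
move=> w1; transitivity
  (\sum_B prodw w B * \prod_k (if k == k0 then f (B k) else 1)).
  by apply: eq_bigr => B _; rewrite -big_mkcond big_pred1_eq.
rewrite (sum_prodw_tilt w (fun k b => if k == k0 then f b else 1)).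
rewrite (bigD1 k0) //= eqxx [X in _ * X]big1 ?mulr1 // => k /negPf kk0.
by rewrite -[RHS](w1 k); apply: eq_bigr => b _; rewrite kk0 mulr1.
Qed.

Lemma sum_prodw_coord2 (R : realType) (K : finType) (w : K -> bool -> R)
    (k1 k2 : K) (f g : bool -> R) :
  (forall k, \sum_b w k b = 1) -> k1 != k2 ->
  \sum_B prodw w B * (f (B k1) * g (B k2)) =
  (\sum_b w k1 b * f b) * (\sum_b w k2 b * g b).
Proof.
move=> w1 k12; pose h k b := if k == k1 then f b else if k == k2 then g b else 1.
have k21 : (k2 == k1) = false by apply/negbTE; rewrite eq_sym.
transitivity (\sum_B prodw w B * \prod_k h k (B k)).
  apply: eq_bigr => B _; rewrite (bigD1 k1) //= (bigD1 k2) ?k21 //= /h eqxx k21 eqxx.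
  by rewrite big1 ?mulr1 // => k /andP[/negPf-> /negPf->].
rewrite sum_prodw_tilt (bigD1 k1) //= (bigD1 k2) ?k21 //= /h eqxx k21 eqxx.
rewrite [X in _ * (_ * X)]big1 ?mulr1 // => k /andP[/negPf k1' /negPf k2'].
by rewrite -[RHS](w1 k); apply: eq_bigr => b _; rewrite k1' k2' mulr1.
Qed.

(** Centred coordinates are uncorrelated under a product law, so only the diagonal terms survive;
    each variance is at most the raw second moment. *)
Lemma sum_prodw_sqr_le (R : realType) (K : finType) (w f : K -> bool -> R) :
  (forall k b, 0 <= w k b) -> (forall k, \sum_b w k b = 1) ->
  \sum_B prodw w B * (\sum_k f k (B k) - \sum_k \sum_b w k b * f k b) ^+ 2
  <= \sum_k \sum_b w k b * f k b ^+ 2.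
Proof.
move=> w0 w1; pose m k := \sum_b w k b * f k b.
pose g k b := f k b - m k.
have Eg k : \sum_b w k b * g k b = 0.
  under eq_bigr do rewrite mulrBr.
  by rewrite sumrB -mulr_suml w1 mul1r subrr.
have -> : \sum_B prodw w B * (\sum_k f k (B k) - \sum_k m k) ^+ 2 =
          \sum_k1 \sum_k2 \sum_B prodw w B * (g k1 (B k1) * g k2 (B k2)).
  under [RHS]eq_bigr do rewrite exchange_big.
  rewrite [RHS]exchange_big; apply: eq_bigr => B _ /=.
  rewrite -sumrB expr2 mulr_suml mulr_sumr; apply: eq_bigr => k1 _.
  by rewrite !mulr_sumr.
apply: ler_sum => k1 _; rewrite (bigD1 k1) //= [X in _ + X]big1 ?addr0; last first.
  move=> k2 k21; rewrite (@sum_prodw_coord2 _ _ w k1 k2 (g k1) (g k2)) //; last by rewrite eq_sym.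
  by rewrite Eg mul0r.
rewrite (@sum_prodw_coord _ _ w k1 (fun b => g k1 b * g k1 b)) //.
have -> : \sum_b w k1 b * f k1 b ^+ 2 =
    \sum_b w k1 b * (g k1 b * g k1 b) + m k1 ^+ 2.
  transitivity (\sum_b (w k1 b * (g k1 b * g k1 b) + (2 * m k1) * (w k1 b * f k1 b) - m k1 ^+ 2 * w k1 b)).
    by apply: eq_bigr => b _; rewrite /g; ring.
  rewrite sumrB big_split /= -!mulr_sumr w1 -/(m k1); ring.
by rewrite lerDl sqr_ge0.
Qed.

(** For positive [u] and [v] the weight [u b * expR (- t * llr u v b)] is the geometric
    interpolation u^(1-t) v^t, and its total mass [tiltZ] is the Chernoff affinity. [tiltV] is the
    raw second moment, not the variance. *)
Definition llr (R : realType) (u v : bool -> R) (b : bool) : R := ln (u b) - ln (v b).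
Definition tiltZ (R : realType) (t : R) (u v : bool -> R) : R :=
  \sum_b u b * expR (- t * llr u v b).
Definition tiltw (R : realType) (t : R) (u v : bool -> R) (b : bool) : R :=
  u b * expR (- t * llr u v b) / tiltZ t u v.
Definition tiltE (R : realType) (t : R) (u v : bool -> R) : R :=
  \sum_b tiltw t u v b * llr u v b.
Definition tiltV (R : realType) (t : R) (u v : bool -> R) : R :=
  \sum_b tiltw t u v b * llr u v b ^+ 2.

Lemma tiltZ_gt0 (R : realType) (t : R) (u v : bool -> R) :
  (forall b, 0 < u b) -> 0 < tiltZ t u v.
Proof. by move=> u0; rewrite /tiltZ big_bool addr_gt0 // mulr_gt0 ?expR_gt0. Qed.

Lemma tiltw_ge0 (R : realType) (t : R) (u v : bool -> R) b :
  (forall b, 0 < u b) -> 0 <= tiltw t u v b.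
Proof.
by move=> u0; rewrite divr_ge0 ?mulr_ge0 ?expR_ge0 //; apply/ltW => //; exact: tiltZ_gt0.
Qed.

Lemma sum_tiltw (R : realType) (t : R) (u v : bool -> R) :
  (forall b, 0 < u b) -> \sum_b tiltw t u v b = 1.
Proof. by move=> u0; rewrite -mulr_suml divff // gt_eqF //; exact: tiltZ_gt0. Qed.

(** Completing the square. A small [kappa] makes the quadratic term negligible at the price of an
    additive constant. *)
Lemma normr_le_sqr (R : realType) (kappa d : R) : 0 < kappa ->
  `|d| <= kappa * d ^+ 2 + (4 * kappa)^-1.
Proof.
move=> k0; have := sqr_ge0 (2 * kappa * `|d| - 1).
have -> : (2 * kappa * `|d| - 1) ^+ 2 =
  4 * kappa * (kappa * d ^+ 2 + (4 * kappa)^-1 - `|d|).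
  rewrite -(real_normK (num_real d)); field; lra.
rewrite pmulr_rge0 ?subr_ge0 //; lra.
Qed.

(** As functions of [s] the two exponents have slopes [t] and [- (1 - t)], at most 1 in size, and
    meet at [s = x] with value [t * x]. When [t = 0] the first is constantly 0 and the second is at
    least [y - s], because [y <= x]. *)
Lemma min_expR_ge (R : realType) (t x y s : R) : 0 <= t <= 1 ->
  y = x \/ t = 0 /\ y <= x ->
  expR (t * x - `|s - y|) <= Num.min (expR (t * s)) (expR (x - (1 - t) * s)).
Proof.
move=> /andP[t0 t1] H; rewrite le_min !ler_expR.
have [H1 H2] : s - y <= `|s - y| /\ - (s - y) <= `|s - y|.
  by split; [exact: ler_norm|rewrite -normrN; exact: ler_norm].
have n0 : 0 <= `|s - y| by [].
by case: H => [yx|[-> yx]]; [subst y|]; apply/andP; split; nra.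
Qed.


(* Change of measure to the exponential tilt [P^(1-t) Q^t], then Jensen. *)
Lemma sum_min_tilt (R : realType) (K : finType) (P Q : K -> bool -> R)
    (t x y kappa : R) :
  (forall k b, 0 < P k b) -> (forall k b, 0 < Q k b) ->
  0 <= t <= 1 -> 0 < kappa -> y = x \/ t = 0 /\ y <= x ->
  expR (\sum_k ln (tiltZ t (P k) (Q k)) + t * x
        - kappa * (\sum_k tiltV t (P k) (Q k)) - (4 * kappa)^-1
        - `|\sum_k tiltE t (P k) (Q k) - y|)
  <= \sum_B Num.min (prodw P B) (expR x * prodw Q B).
Proof.
move=> P0 Q0 t01 k0 H.
set Z := \sum_k _; set V := \sum_k _; set m := \sum_k _.
pose w k := tiltw t (P k) (Q k).
have w0 k b : 0 <= w k b by exact: tiltw_ge0.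
have w1 k : \sum_b w k b = 1 by exact: sum_tiltw.
pose Lam (B : {ffun K -> bool}) := \sum_k llr (P k) (Q k) (B k).
have Zk k : 0 < tiltZ t (P k) (Q k) by exact: tiltZ_gt0.
(* Both laws are written against the common tilted law [w]; only the factors depending on [Lam]
   differ. *)
have PE B : prodw P B = expR Z * prodw w B * expR (t * Lam B).
  rewrite /Z /Lam mulr_sumr !expR_sum /prodw -!big_split /=; apply: eq_bigr => k _.
  rewrite lnK ?posrE // /w /tiltw mulNr expRN; field.
  by rewrite !gt_eqF ?expR_gt0.
have QE B : expR x * prodw Q B = expR Z * prodw w B * expR (x - (1 - t) * Lam B).
  rewrite expRD mulrCA; congr (_ * _).
  rewrite -mulNr /Z /Lam mulr_sumr !expR_sum /prodw -!big_split /=; apply: eq_bigr => k _.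
  have -> : Q k (B k) = P k (B k) * expR (- llr (P k) (Q k) (B k)).
    by rewrite /llr opprB expRD expRN !lnK ?posrE // mulrCA divff ?mulr1 // gt_eqF.
  rewrite lnK ?posrE // /w /tiltw.
  rewrite [- (1 - t) * _](_ : _ = - llr (P k) (Q k) (B k) - (- t * llr (P k) (Q k) (B k))); last by ring.
  rewrite expRB; field.
  by rewrite !gt_eqF ?expR_gt0.
apply: (@le_trans _ _ (expR Z * \sum_B prodw w B * expR (t * x - `|Lam B - y|))); last first.
  rewrite mulr_sumr; apply: ler_sum => B _.
  rewrite PE QE -minr_pMr; last by rewrite mulr_ge0 ?expR_ge0 ?prodw_ge0.
  by rewrite mulrA ler_wpM2l ?min_expR_ge // mulr_ge0 ?expR_ge0 ?prodw_ge0.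
have J := @expR_jensen R _ (prodw w) (fun B => t * x - `|Lam B - y|)
  (fun B => prodw_ge0 B w0) (sum_prodw w1).
apply: le_trans (ler_wpM2l (expR_ge0 Z) J).
rewrite -expRD ler_expR -!addrA lerD2l.
have E2 : \sum_B prodw w B * (Lam B - m) ^+ 2 <= V.
  exact: (@sum_prodw_sqr_le _ _ w (fun k => llr (P k) (Q k))).
(* [|Lam B - y|] splits into the fluctuation about the tilted mean [m], paid for by the second
   moment, and the bias [|m - y|]. *)
apply: (@le_trans _ _ (\sum_B prodw w B * (t * x - (kappa * (Lam B - m) ^+ 2 + (4 * kappa)^-1 + `|m - y|)))); last first.
  apply: ler_sum => B _; rewrite ler_wpM2l ?prodw_ge0 // lerD2l lerN2.
  have -> : Lam B - y = (Lam B - m) + (m - y) by ring.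
  by rewrite (le_trans (ler_normD _ _)) // lerD2r normr_le_sqr.
have -> : \sum_B prodw w B * (t * x - (kappa * (Lam B - m) ^+ 2 + (4 * kappa)^-1 + `|m - y|))
   = (t * x - (4 * kappa)^-1 - `|m - y|) * (\sum_B prodw w B)
     - kappa * \sum_B prodw w B * (Lam B - m) ^+ 2.
  by rewrite !mulr_sumr -sumrB; apply: eq_bigr => B _; ring.
rewrite sum_prodw // mulr1.
have : kappa * \sum_B prodw w B * (Lam B - m) ^+ 2 <= kappa * V by rewrite ler_pM2l.
lra.
Qed.

(** * Bernoulli estimates *)

Definition bernw (R : realType) (a : R) (b : bool) : R := bern b a.

Lemma bernw_gt0 (R : realType) (a : R) b : 0 < a < 1 -> 0 < bernw a b.
Proof. by move=> /andP[a0 a1]; rewrite /bernw /bern; case: b; lra. Qed.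

Lemma sum_bernw (R : realType) (a : R) : \sum_b bernw a b = 1.
Proof. by rewrite big_bool /bernw /bern /=; ring. Qed.

Lemma lnB_le (R : realType) (a b : R) : 0 < a -> 0 < b -> ln a - ln b <= (a - b) / b.
Proof.
move=> a0 b0; rewrite -ln_div ?posrE // mulrBl divff ?gt_eqF //.
have := @le_ln1Dx R (a / b - 1); rewrite [1 + _]addrC subrK; apply.
have : 0 < a / b by rewrite divr_gt0.
lra.
Qed.

Lemma normr_lnB_le (R : realType) (q a b : R) : 0 < q -> q <= a -> q <= b ->
  `|ln a - ln b| <= `|a - b| / q.
Proof.
move=> q0 qa qb; have a0 : 0 < a by lra.
have b0 : 0 < b by lra.
have K c d : 0 < c -> 0 < d -> q <= d -> ln c - ln d <= `|c - d| / q.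
  move=> c0 d0 qd; apply: le_trans (lnB_le c0 d0) _.
  apply: (@le_trans _ _ (`|c - d| / d)).
    by apply: ler_wpM2r; [rewrite invr_ge0 ltW|exact: ler_norm].
  by rewrite ler_wpM2l // lef_pV2.
by rewrite ler_norml K // andbT lerNl opprB distrC K.
Qed.

(** Bounding ln r by r - 1 turns the Kullback-Leibler divergence into the chi-square one, (a-b)^2 /
    (b(1-b)), and b(1-b) >= q/2. *)
Lemma kl_bernw_le (R : realType) (q a b : R) : 0 < q -> q <= a <= 1 / 2 ->
  q <= b <= 1 / 2 ->
  \sum_x bernw a x * llr (bernw a) (bernw b) x <= 2 * ((a - b) ^+ 2 / q).
Proof.
move=> q0 /andP[qa a2] /andP[qb b2].
rewrite big_bool /llr /bernw /bern /=.
have a0 : 0 < a by lra.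
have b0 : 0 < b by lra.
have a1 : 0 < 1 - a by lra.
have b1 : 0 < 1 - b by lra.
have H1 := ler_wpM2l (ltW a0) (lnB_le a0 b0).
have H2 := ler_wpM2l (ltW a1) (lnB_le a1 b1).
apply: le_trans (lerD H1 H2) _.
have -> : a * ((a - b) / b) + (1 - a) * ((1 - a - (1 - b)) / (1 - b)) =
  (a - b) ^+ 2 * (b * (1 - b))^-1 by field; rewrite !gt_eqF.
rewrite mulrCA ler_wpM2l ?sqr_ge0 //.
have -> : 2 / q = (q / 2)^-1 by field; rewrite gt_eqF.
by rewrite lef_pV2 ?posrE ?mulr_gt0 //; nra.
Qed.

(** The outcome [false] suffices: [1 - a] and [1 - b] are both at least 1/2, hence so is their
    weighted geometric mean. *)
Lemma tiltZ_bernw_ge (R : realType) (t q a b : R) : 0 <= t <= 1 -> 0 < q ->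
  q <= a <= 1 / 2 -> q <= b <= 1 / 2 -> 1 / 2 <= tiltZ t (bernw a) (bernw b).
Proof.
move=> /andP[t0 t1] q0 /andP[qa a2] /andP[qb b2].
rewrite /tiltZ big_bool /llr /bernw /bern /=.
have a0 : 0 < a by lra.
have b0 : 0 < b by lra.
have a1 : 0 < 1 - a by lra.
have b1 : 0 < 1 - b by lra.
have := mulr_ge0 (ltW a0) (expR_ge0 (- t * (ln a - ln b))).
suff : 1 / 2 <= (1 - a) * expR (- t * (ln (1 - a) - ln (1 - b))) by lra.
have h0 : (0 : R) < 1 / 2 by lra.
rewrite -[X in _ <= X * _](lnK a1) -expRD -[X in X <= _](lnK h0) ler_expR.
have : ln (1 / 2) <= ln (1 - a) by rewrite ler_ln ?posrE //; lra.
have : ln (1 / 2) <= ln (1 - b) by rewrite ler_ln ?posrE //; lra.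
nra.
Qed.

(** Since e^(-sl) l <= l for s >= 0, the unnormalised tilted mean lies between its values at [t = 1]
    and [t = 0], which are minus the divergence of [b] from [a] and the divergence of [a] from [b].
    Dividing by the normaliser, at least 1/2, doubles the constant. *)
Lemma tiltE_bernw_le (R : realType) (t q a b : R) : 0 <= t <= 1 -> 0 < q ->
  q <= a <= 1 / 2 -> q <= b <= 1 / 2 ->
  `|tiltE t (bernw a) (bernw b)| <= 4 * ((a - b) ^+ 2 / q).
Proof.
move=> t01 q0 ha hb; have Z2 := tiltZ_bernw_ge t01 q0 ha hb.
have D0 : 0 <= (a - b) ^+ 2 / q by rewrite divr_ge0 ?sqr_ge0 ?ltW.
have a01 : 0 < a < 1 by lra.
have b01 : 0 < b < 1 by lra.
have [t0 t1] := andP t01.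
have Zp : 0 < tiltZ t (bernw a) (bernw b) by lra.
set lam := llr (bernw a) (bernw b).
have ZE : tiltZ t (bernw a) (bernw b) * tiltE t (bernw a) (bernw b) =
   \sum_x bernw a x * (expR (- t * lam x) * lam x).
  rewrite /tiltE mulr_sumr; apply: eq_bigr => x _.
  by rewrite /tiltw -/lam; field; rewrite gt_eqF.
have mono s l : 0 <= s -> l <= expR (s * l) * l :> R.
  move=> s0; have [l0|l0] := leP 0 l.
    by rewrite ler_peMl // -expR0 ler_expR mulr_ge0.
  rewrite -subr_ge0; have : expR (s * l) <= 1 by rewrite -expR0 ler_expR mulr_ge0_le0 // ltW.
  nra.
have mono' s l : 0 <= s -> expR (- s * l) * l <= l :> R.
  by move=> s0; have := mono s (- l) s0; rewrite !mulrN mulNr; lra.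
have U : tiltZ t (bernw a) (bernw b) * tiltE t (bernw a) (bernw b) <= 2 * ((a - b) ^+ 2 / q).
  rewrite ZE; apply: le_trans (kl_bernw_le q0 ha hb).
  by apply: ler_sum => x _; rewrite ler_wpM2l ?mono' //; apply/ltW/bernw_gt0.
have L : - (2 * ((a - b) ^+ 2 / q)) <= tiltZ t (bernw a) (bernw b) * tiltE t (bernw a) (bernw b).
  rewrite ZE lerNl; have := kl_bernw_le q0 hb ha.
  rewrite -[(b - a) ^+ 2]sqrrN opprB; apply: le_trans.
  rewrite -sumrN; apply: ler_sum => x _.
  have -> : llr (bernw b) (bernw a) x = - lam x by rewrite /lam /llr opprB.
  rewrite mulrN lerN2.
  (* With [b] as base law the tilt exponent becomes [1 - t >= 0], so [mono] gives the reverse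
     bound. *)
  have -> : bernw a x * (expR (- t * lam x) * lam x) =
     bernw b x * (expR ((1 - t) * lam x) * lam x).
    have -> : bernw a x = bernw b x * expR (lam x).
      by rewrite /lam /llr expRB !lnK ?posrE ?bernw_gt0 // mulrCA divff ?mulr1 // gt_eqF ?bernw_gt0.
    have -> : (1 - t) * lam x = lam x + - t * lam x by ring.
    by rewrite expRD; ring.
  by rewrite ler_wpM2l ?mono ?subr_ge0 //; apply/ltW/bernw_gt0.
rewrite ler_norml; apply/andP; split; nra.
Qed.

(** Pointwise weighted AM-GM, obtained from the two-point case of Jensen's inequality. *)
Lemma tiltZ_bernw_le1 (R : realType) (t a b : R) : 0 <= t <= 1 ->
  0 < a < 1 -> 0 < b < 1 -> tiltZ t (bernw a) (bernw b) <= 1.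
Proof.
move=> /andP[t0 t1] a01 b01.
have cvx l : expR (- t * l) <= (1 - t) + t * expR (- l).
  have := @expR_jensen R bool (fun c => if c then t else 1 - t) (fun c => if c then - l else 0).
  rewrite !big_bool /= expR0 mulr0 mulr1 addr0 mulrN mulNr => H.
  rewrite addrC; apply: H; last lra.
  by case; lra.
rewrite -[X in _ <= X](_ : \sum_x ((1 - t) * bernw a x + t * bernw b x) = _); last first.
  by rewrite big_split /= -!mulr_sumr !sum_bernw; ring.
apply: ler_sum => x _.
have -> : bernw b x = bernw a x * expR (- llr (bernw a) (bernw b) x).
  by rewrite /llr opprB expRB !lnK ?posrE ?bernw_gt0 // mulrCA divff ?mulr1 // gt_eqF ?bernw_gt0.
have -> (e : R) : (1 - t) * bernw a x + t * (bernw a x * e) = bernw a x * ((1 - t) + t * e) by ring.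
by rewrite ler_wpM2l ?cvx //; apply/ltW/bernw_gt0.
Qed.

(** The logarithm is nonpositive, and by Jensen it is at least [- t] times the divergence. *)
Lemma ln_tiltZ_bernw_le (R : realType) (t q a b : R) : 0 <= t <= 1 -> 0 < q ->
  q <= a <= 1 / 2 -> q <= b <= 1 / 2 ->
  `|ln (tiltZ t (bernw a) (bernw b))| <= 2 * ((a - b) ^+ 2 / q).
Proof.
move=> t01 q0 ha hb.
have D0 : 0 <= (a - b) ^+ 2 / q by rewrite divr_ge0 ?sqr_ge0 ?ltW.
have a01 : 0 < a < 1 by lra.
have b01 : 0 < b < 1 by lra.
have [t0 t1] := andP t01.
rewrite ler0_norm; last by rewrite -ln1 ler_ln ?posrE ?tiltZ_bernw_le1 ?tiltZ_gt0 // => x; exact: bernw_gt0.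
rewrite lerNl -[X in X <= _]expRK ler_ln ?posrE ?expR_gt0 //; last by apply: tiltZ_gt0 => x; exact: bernw_gt0.
have := @expR_jensen R bool (bernw a) (fun x => - t * llr (bernw a) (bernw b) x).
move=> /(_ (fun x => ltW (bernw_gt0 x a01)) (sum_bernw a)); apply: le_trans.
rewrite ler_expR.
have -> : \sum_x bernw a x * (- t * llr (bernw a) (bernw b) x) = - t * \sum_x bernw a x * llr (bernw a) (bernw b) x.
  by rewrite mulr_sumr; apply: eq_bigr => x _; ring.
have := kl_bernw_le q0 ha hb; nra.
Qed.

(** On [true] the weight is of order [C * q] and the log-ratio at most [|a - b| / q]; on [false] the
    weight is at most 1 and the log-ratio at most [2 * |a - b|]. *)
Lemma tiltV_bernw_le (R : realType) (C t q a b : R) : 0 <= t <= 1 -> 0 < q ->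
  q <= a <= 1 / 2 -> q <= b <= 1 / 2 -> a <= C * q -> b <= C * q ->
  tiltV t (bernw a) (bernw b) <= (2 * C + 2) * ((a - b) ^+ 2 / q).
Proof.
move=> t01 q0 ha hb aC bC.
have Z2 := tiltZ_bernw_ge t01 q0 ha hb.
have a01 : 0 < a < 1 by lra.
have b01 : 0 < b < 1 by lra.
have [t0 t1] := andP t01.
have [qa a2] := andP ha; have [qb b2] := andP hb.
have W0 : 0 <= tiltw t (bernw a) (bernw b) false by apply: tiltw_ge0 => x; exact: bernw_gt0.
have W1 : 0 <= tiltw t (bernw a) (bernw b) true by apply: tiltw_ge0 => x; exact: bernw_gt0.
have := @sum_tiltw R t (bernw a) (bernw b) (fun x => bernw_gt0 x a01).
rewrite /tiltV !big_bool /= => S1.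
have WT : tiltw t (bernw a) (bernw b) true <= 2 * (C * q).
  rewrite /tiltw /llr /bernw /bern /= ler_pdivrMr; last lra.
  have C0 : 0 < C * q by lra.
  have a0 : 0 < a by lra.
  have : a * expR (- t * (ln a - ln b)) <= C * q.
    rewrite -[X in X * _](lnK a0) -expRD -[X in _ <= X](lnK C0) ler_expR.
    have : ln a <= ln (C * q) by rewrite ler_ln ?posrE.
    have : ln b <= ln (C * q) by rewrite ler_ln ?posrE //; lra.
    nra.
  nra.
have LT : llr (bernw a) (bernw b) true ^+ 2 <= (a - b) ^+ 2 / q ^+ 2.
  rewrite -real_normK ?num_real // -[(a - b) ^+ 2]real_normK ?num_real // -expr_div_n.
  by rewrite ler_sqr ?nnegrE ?divr_ge0 ?normr_ge0 ?(ltW q0) //; exact: normr_lnB_le.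
have LF : llr (bernw a) (bernw b) false ^+ 2 <= 4 * (a - b) ^+ 2.
  have h : `|llr (bernw a) (bernw b) false| <= 2 * `|a - b|.
    have h0 : (0 : R) < 1 / 2 by lra.
    have := @normr_lnB_le R (1 / 2) (1 - a) (1 - b) h0.
    rewrite /llr /bernw /bern /=.
    have -> : 1 - a - (1 - b) = - (a - b) by ring.
    rewrite normrN => H.
    have -> : 2 * `|a - b| = `|a - b| / (1 / 2) by field.
    by apply: H; lra.
  rewrite -real_normK ?num_real // -[(a - b) ^+ 2]real_normK ?num_real //.
  have := normr_ge0 (llr (bernw a) (bernw b) false); nra.
have E1 : tiltw t (bernw a) (bernw b) true * llr (bernw a) (bernw b) true ^+ 2
   <= 2 * C * ((a - b) ^+ 2 / q).
  have -> : 2 * C * ((a - b) ^+ 2 / q) = 2 * (C * q) * ((a - b) ^+ 2 / q ^+ 2) by field; rewrite gt_eqF.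
  by rewrite ler_pM ?sqr_ge0.
have E2 : tiltw t (bernw a) (bernw b) false * llr (bernw a) (bernw b) false ^+ 2
   <= 2 * ((a - b) ^+ 2 / q).
  have D2 : 2 * (a - b) ^+ 2 <= (a - b) ^+ 2 / q.
    by rewrite mulrC ler_wpM2l ?sqr_ge0 // -[2]invrK lef_pV2 ?posrE //; lra.
  apply: (@le_trans _ _ (1 * (4 * (a - b) ^+ 2))); last lra.
  by rewrite ler_pM ?sqr_ge0 //; lra.
by rewrite mulrDl lerD.
Qed.

(** The two factors inside the logarithm are the affinities of the two directions: an edge law
    changing from [p] to [q], and from [q] to [p]. *)
Lemma Iinfo_tiltZ (R : realType) (p q t : R) : 0 < p < 1 -> 0 < q < 1 ->
  Iinfo p q t = - (ln (tiltZ t (bernw p) (bernw q)) + ln (tiltZ t (bernw q) (bernw p))).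
Proof.
move=> p01 q01; rewrite /Iinfo -lnM ?posrE ?tiltZ_gt0 //; try by move=> x; exact: bernw_gt0.
have E a b : 0 < a -> 0 < b -> a `^ (1 - t) * b `^ t = a * expR (- t * (ln a - ln b)).
  move=> a0 b0; rewrite /powR (gt_eqF a0) (gt_eqF b0).
  have -> : a * expR (- t * (ln a - ln b)) = expR (ln a) * expR (- t * (ln a - ln b)).
    by rewrite (lnK a0).
  rewrite -!expRD.
  by have -> : (1 - t) * ln a + t * ln b = ln a + - t * (ln a - ln b) by ring.
have [p0 p1] := andP p01; have [q0 q1] := andP q01.
rewrite !E ?subr_gt0 // ![_ `^ t * _]mulrC !E ?subr_gt0 //.
by rewrite /tiltZ !big_bool.
Qed.

(** At [t = 1 / 2] both affinities equal the Bhattacharyya coefficient Z, and -ln Z >= 1 - Z, half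
    the squared Hellinger distance. Then (p-q)^2 factors through the square roots, and (sqrt p +
    sqrt q)^2 <= 4p <= 4Cq. *)
Lemma Iinfo_half_ge (R : realType) (C p q : R) : 0 < q -> q < p -> p <= 1 / 2 -> p <= C * q ->
  (p - q) ^+ 2 / q <= 4 * C * Iinfo p q (1 / 2).
Proof.
move=> q0 qp p2 pC.
have p0 : 0 < p by lra.
have p01 : 0 < p < 1 by lra.
have q01 : 0 < q < 1 by lra.
have C0 : 0 < C by rewrite -(pmulr_lgt0 _ q0); lra.
rewrite Iinfo_tiltZ //.
have h (a b : R) : 0 < a -> 0 < b -> a * expR (- (1/2) * (ln a - ln b)) = expR (1/2 * ln a) * expR (1/2 * ln b).
  move=> a0 b0; rewrite -[X in X * _](lnK a0) -!expRD; congr expR; lra.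
have sq (a : R) : 0 < a -> expR (1/2 * ln a) ^+ 2 = a.
  by move=> a0; rewrite expr2 -expRD -[RHS](lnK a0); congr expR; lra.
have p1 : 0 < 1 - p by lra.
have q1 : 0 < 1 - q by lra.
have ZE : tiltZ (1 / 2) (bernw q) (bernw p) = tiltZ (1 / 2) (bernw p) (bernw q).
  rewrite /tiltZ !big_bool /llr /bernw /bern /=.
  rewrite (h q p q0 p0) (h p q p0 q0) (h (1 - q) (1 - p) q1 p1) (h (1 - p) (1 - q) p1 q1).
  by rewrite ![expR (1 / 2 * ln q) * _]mulrC ![expR (1 / 2 * ln (1 - q)) * _]mulrC.
rewrite ZE; set Z := tiltZ _ _ _.
have Z0 : 0 < Z by apply: tiltZ_gt0 => x; exact: bernw_gt0.
have lnZ : ln Z <= Z - 1 by have := @le_ln1Dx R (Z - 1); rewrite [1 + _]addrC subrK; apply; lra.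
suff K : (p - q) ^+ 2 / q <= 8 * C * (1 - Z).
  apply: le_trans K _.
  have -> : 4 * C * - (ln Z + ln Z) = 8 * C * (- ln Z) by ring.
  by rewrite ler_wpM2l; lra.
rewrite ler_pdivrMr //.
have -> : Z = expR (1/2 * ln p) * expR (1/2 * ln q) + expR (1/2 * ln (1 - p)) * expR (1/2 * ln (1 - q)).
  by rewrite /Z /tiltZ !big_bool /llr /bernw /bern /= (h p q p0 q0) (h (1 - p) (1 - q) p1 q1).
move: (sq _ p0) (sq _ q0) (sq _ p1) (sq _ q1).
have [] : 0 < expR (1/2 * ln p) /\ 0 < expR (1/2 * ln q) by rewrite !expR_gt0.
move: (expR (1/2 * ln p)) (expR (1/2 * ln q)) (expR (1/2 * ln (1 - p))) (expR (1/2 * ln (1 - q))).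
move=> sp sq' sp' sq'' sp0 sq0 Ep Eq Ep' Eq'.
have -> : 8 * C * (1 - (sp * sq' + sp' * sq'')) * q = 4 * (C * q) * ((sp - sq') ^+ 2 + (sp' - sq'') ^+ 2).
  rewrite !sqrrB Ep Eq Ep' Eq'; ring.
have -> : (p - q) ^+ 2 = (sp - sq') ^+ 2 * (sp + sq') ^+ 2 by rewrite -Ep -Eq; ring.
have sle : sq' <= sp.
  have sp1 := ltW sp0; have sq1 := ltW sq0.
  by rewrite -ler_sqr ?nnegrE // Ep Eq; exact: ltW.
have : (sp + sq') ^+ 2 <= 4 * p by rewrite -Ep; nra.
have := sqr_ge0 (sp - sq'); have := sqr_ge0 (sp' - sq''); nra.
Qed.

(** * Continuity and symmetry of the tilted mean *)

Lemma continuous_tiltE (R : realType) (u v : bool -> R) : (forall b, 0 < u b) ->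
  continuous (fun t => tiltE t u v).
Proof.
move=> u0 t.
have cE b : {for t, continuous (fun s : R => u b * expR (- s * llr u v b))}.
  apply: continuousM; first exact: cst_continuous.
  apply: continuous_comp; last exact: continuous_expR.
  apply: continuousM; last exact: cst_continuous.
  by apply: continuousN; exact: cvg_id.
have cZ : {for t, continuous (fun s : R => tiltZ s u v)}.
  rewrite (_ : (fun s => tiltZ s u v) = (fun s => u true * expR (- s * llr u v true) + u false * expR (- s * llr u v false))); last first.
    by apply/funext => s; rewrite /tiltZ big_bool.
  by apply: continuousD.
have cw b : {for t, continuous (fun s : R => tiltw s u v b * llr u v b)}.
  apply: continuousM; last exact: cst_continuous.
  apply: continuousM => //; apply: continuousV => //.
  by rewrite gt_eqF ?tiltZ_gt0.
have cT : {for t, continuous (fun s : R => tiltw s u v true * llr u v true + tiltw s u v false * llr u v false)}.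
  by apply: continuousD.
rewrite (_ : (fun s => tiltE s u v) = (fun s => tiltw s u v true * llr u v true + tiltw s u v false * llr u v false)); last first.
  by apply/funext => s; rewrite /tiltE big_bool.
exact: cT.
Qed.

(** The midpoint tilt is symmetric in the two laws while the log-ratio changes sign. This supplies
    the zero from which the intermediate value theorem starts. *)
Lemma tiltE_half_anti (R : realType) (u v : bool -> R) :
  (forall b, 0 < u b) -> (forall b, 0 < v b) ->
  tiltE (1 / 2) v u = - tiltE (1 / 2) u v.
Proof.
move=> u0 v0.
have h x : v x * expR (- (1 / 2) * llr v u x) = u x * expR (- (1 / 2) * llr u v x).
  rewrite -[X in X * _](lnK (v0 x)) -[X in _ = X * _](lnK (u0 x)) -!expRD /llr; congr expR; lra.
have Z : tiltZ (1 / 2) v u = tiltZ (1 / 2) u v by apply: eq_bigr => x _; exact: h.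
rewrite /tiltE -sumrN; apply: eq_bigr => x _.
rewrite /tiltw h Z.
have -> : llr v u x = - llr u v x by rewrite /llr opprB.
by rewrite mulrN.
Qed.

(** * Edge laws given the layer labels *)

Definition edge (n L : nat) :=
  {k : 'I_L * 'I_n * 'I_n | k \in [pred k : 'I_L * 'I_n * 'I_n | (k.1.2 < k.2)%N]}.

(** Only pairs with i < j are random, so indexing by them makes the edge law a true product. On the
    diagonal [insub] fails and the default [false] is taken. *)
Definition sym_obs (n L : nat) (B : {ffun edge n L -> bool}) : obs n L :=
  [ffun k : 'I_L * 'I_n * 'I_n =>
    oapp B false (insub (if (k.1.2 < k.2)%N then k else (k.1.1, k.2, k.1.2)))].

Lemma sym_obsE (n L : nat) (B : {ffun edge n L -> bool}) k : sym_obs B (val k) = B k.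
Proof. by rewrite ffunE; move: (valP k); rewrite inE => ->; rewrite valK. Qed.

Lemma sym_obs_inj (n L : nat) : injective (@sym_obs n L).
Proof. by move=> B B' /ffunP E; apply/ffunP => k; rewrite -!sym_obsE E. Qed.

Lemma valid_sym_obs (n L : nat) (B : {ffun edge n L -> bool}) : valid_adj (sym_obs B).
Proof.
apply/forallP => l; apply/forallP => i; apply/forallP => j.
have -> : sym_obs B (l, i, i) = false by rewrite ffunE /= ltnn insubF // inE /= ltnn.
by rewrite andbT !ffunE /=; case: ltngtP => // /val_inj ->.
Qed.

Definition edge_par (R : realType) (n L : nat) (p q : nat -> R)
    (zl : 'I_L -> 'I_n -> bool) (k : 'I_L * 'I_n * 'I_n) : R :=
  if zl k.1.1 k.1.2 == zl k.1.1 k.2 then p k.1.1 else q k.1.1.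

Lemma big_edge (R : Type) (idx : R) (op : Monoid.com_law idx) (n L : nat)
    (F : 'I_L * 'I_n * 'I_n -> R) :
  \big[op/idx]_(k : edge n L) F (val k) =
  \big[op/idx]_(l : 'I_L) \big[op/idx]_(i : 'I_n) \big[op/idx]_(j : 'I_n | (i < j)%N) F (l, i, j).
Proof.
rewrite -big_sub pair_big /= pair_big_dep /=.
by apply: eq_big => [[[l i] j]|[[l i] j]].
Qed.

Lemma adj_prob_sym_obs (R : realType) (n L : nat) (p q : nat -> R)
    (zl : 'I_L -> 'I_n -> bool) (B : {ffun edge n L -> bool}) :
  adj_prob p q zl (sym_obs B) = prodw (fun k => bernw (edge_par p q zl (val k))) B.
Proof.
rewrite /adj_prob valid_sym_obs mul1r /prodw.
rewrite -(@big_edge _ _ _ n L (fun k => bern (sym_obs B k) (edge_par p q zl k))).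
by apply: eq_bigr => k _; rewrite sym_obsE.
Qed.

Lemma adj_prob_ge0 (R : realType) (n L : nat) (p q : nat -> R)
    (zl : 'I_L -> 'I_n -> bool) (A : obs n L) :
  (forall l, (l < L)%N -> 0 < p l < 1 /\ 0 < q l < 1) -> 0 <= adj_prob p q zl A.
Proof.
move=> pq; rewrite mulr_ge0 //; apply: prodr_ge0 => l _; apply: prodr_ge0 => i _.
apply: prodr_ge0 => j _; have [pl ql] := pq l (ltn_ord l).
by apply/ltW/(@bernw_gt0 R _ (A (l, i, j))); case: ifP.
Qed.

Lemma ler_sum_inj (R : realType) (I J : finType) (h : I -> J) (F : J -> R) :
  injective h -> (forall j, 0 <= F j) -> \sum_i F (h i) <= \sum_j F j.
Proof.
move=> hI F0; rewrite -(big_map h predT F) /= big_uniq /=; last first.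
  by rewrite map_inj_uniq ?index_enum_uniq.
by rewrite big_mkcond /=; apply: ler_sum => j _; case: ifP.
Qed.

(** * Sums over the edges at one node *)

Lemma sum_star (R : realType) (n : nat) (i : 'I_n) (h : 'I_n -> 'I_n -> R) :
  (forall a b, h a b = h b a) ->
  \sum_(a : 'I_n) \sum_(b : 'I_n | (a < b)%N) (if (a == i) || (b == i) then h a b else 0) =
  \sum_(j | j != i) h i j.
Proof.
move=> hC.
rewrite [RHS](bigID (fun j : 'I_n => (i < j)%N)) /= (bigD1 i) //=; congr (_ + _).
  apply: eq_big => [b|b _]; last by rewrite eqxx.
  by case: ltnP => //=; rewrite ?andbT ?andbF // => ib; rewrite -(inj_eq val_inj) gtn_eqF.
rewrite [RHS](eq_bigl (fun a : 'I_n => (a != i) && (a < i)%N)); last first.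
  by move=> a; rewrite -leqNgt leq_eqVlt (inj_eq val_inj); case: eqVneq.
rewrite [RHS]big_mkcondr /=; apply: eq_bigr => a ai.
under eq_bigr do rewrite (negPf ai) /=.
rewrite -big_mkcondr /= hC; case: ifP => ltai.
  by rewrite (big_pred1 i) // => b; rewrite andbC /=; case: eqVneq => // ->.
by rewrite big_pred0 // => b; case: eqVneq => [->|_]; rewrite ?ltai ?andbF.
Qed.

Definition spin (R : realType) (b : bool) : R := if b then 1 else -1.

(** [g (z i == z j)] is affine in the product of the two spins, so the sum is its balanced value
    plus a multiple of the imbalance; the constant 2 pays for the missing index [j = i]. *)
Lemma sum_spin_orient (R : realType) (n : nat) (i : 'I_n) (z : 'I_n -> bool)
    (g : bool -> R) (M : R) :
  (forall b, `|g b| <= M) ->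
  `|\sum_(j | j != i) g (z i == z j) - n%:R / 2 * (g true + g false)|
  <= M * (2 + `|\sum_j spin R (z j)|).
Proof.
move=> gM; set s := \sum_j _.
have E : \sum_(j | j != i) g (z i == z j) =
  (n%:R - 1) / 2 * (g true + g false) + (g true - g false) / 2 * (spin R (z i) * s - 1).
  have -> : \sum_(j | j != i) g (z i == z j) = \sum_j g (z i == z j) - g true.
    by rewrite [X in _ = X - _](bigD1 i) //= eqxx [g _ + _]addrC addrK.
  transitivity (\sum_j ((g true + g false) / 2 + (g true - g false) / 2 * spin R (z i) * spin R (z j)) - g true).
    congr (_ - _); apply: eq_bigr => j _; rewrite /spin.
    by case: (z i); case: (z j) => /=; lra.
  by rewrite big_split /= sumr_const card_ord -[X in _ + X - _]mulr_sumr -/s -[_ *+ n]mulr_natl; field.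
rewrite E.
have -> : (n%:R - 1) / 2 * (g true + g false) + (g true - g false) / 2 * (spin R (z i) * s - 1)
   - n%:R / 2 * (g true + g false) = (g true - g false) / 2 * (spin R (z i) * s - 1) - (g true + g false) / 2 by field.
have bd b : - M <= g b <= M by rewrite -ler_norml.
have /andP[f1 f2] := bd false; have /andP[t1 t2] := bd true.
have sE : `|spin R (z i) * s| = `|s| by rewrite /spin normrM; case: ifP; rewrite ?normrN normr1 mul1r.
have h1 : `|spin R (z i) * s - 1| <= `|s| + 1.
  by rewrite -sE (le_trans (ler_normB _ _)) // normr1.
have h2 : `|(g true - g false) / 2| <= M by rewrite ler_norml; lra.
have h3 : `|(g true + g false) / 2| <= M by rewrite ler_norml; lra.
rewrite (le_trans (ler_normB _ _)) //.
have -> : M * (2 + `|s|) = M * (`|s| + 1) + M by ring.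
by rewrite lerD // normrM ler_pM.
Qed.

Lemma spin_flip_le (R : realType) (n : nat) (z xi : 'I_n -> bool) :
  `|\sum_j spin R (z j (+) xi j)| <= `|\sum_j spin R (z j)| + 2 * \sum_j (xi j)%:R.
Proof.
have -> : \sum_j spin R (z j (+) xi j) =
  \sum_j spin R (z j) + \sum_j (spin R (z j (+) xi j) - spin R (z j)).
  by rewrite -big_split; apply: eq_bigr => j _ /=; ring.
rewrite (le_trans (ler_normD _ _)) // lerD2l mulr_sumr.
rewrite (le_trans (ler_norm_sum _ _ _)) //; apply: ler_sum => j _.
by rewrite /spin; case: (z j); case: (xi j) => /=; rewrite ler_norml; lra.
Qed.

Lemma tiltZ_same (R : realType) (t : R) (u : bool -> R) : \sum_b u b = 1 -> tiltZ t u u = 1.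
Proof.
by move=> u1; rewrite -[RHS]u1; apply: eq_bigr => b _; rewrite /llr subrr mulr0 expR0 mulr1.
Qed.

Lemma tiltE_same (R : realType) (t : R) (u : bool -> R) : tiltE t u u = 0.
Proof. by rewrite /tiltE big1 // => b _; rewrite /llr subrr mulr0. Qed.

Lemma tiltV_same (R : realType) (t : R) (u : bool -> R) : tiltV t u u = 0.
Proof. by rewrite /tiltV big1 // => b _; rewrite /llr subrr expr0n mulr0. Qed.

(** The chi-square divergence of the two edge laws up to the factor [1 - q l]; the common unit for
    all edge costs. *)
Definition chi2 (R : realType) (p q : nat -> R) (l : nat) : R := (p l - q l) ^+ 2 / q l.

(** The form in which $p_\ell\asymp q_\ell=o(1)$ is used at a fixed large [n]: the limit enters only
    through the bound 1/2. *)
Definition sparse (R : realType) (L : nat) (C : R) (p q : nat -> R) :=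
  forall l, (l < L)%N -> [/\ 0 < q l, q l < p l, p l <= 1 / 2 & p l <= C * q l].

(** Flipping node [i] in the layers of [S] exchanges [p] and [q] on the edges at [i] there and
    leaves all other edges alone. [Phi] will be the log-normaliser, the tilted mean and the second
    moment. *)
Lemma sum_edge_star (R : realType) (n L : nat) (p q : nat -> R) (S : {set 'I_L}) (i : 'I_n)
    (zl zl' : 'I_L -> 'I_n -> bool) (Phi : (bool -> R) -> (bool -> R) -> R) :
  (forall l j, zl' l j = zl l j (+) ((j == i) && (l \in S))) ->
  (forall a, Phi (bernw a) (bernw a) = 0) ->
  \sum_(k : edge n L) Phi (bernw (edge_par p q zl (val k))) (bernw (edge_par p q zl' (val k))) =
  \sum_(l in S) \sum_(j | j != i)
    (fun o : bool => Phi (bernw (if o then p l else q l)) (bernw (if o then q l else p l)))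
      (zl l i == zl l j).
Proof.
move=> zE Phi0.
rewrite (@big_edge _ _ _ n L (fun k => Phi (bernw (edge_par p q zl k)) (bernw (edge_par p q zl' k)))).
rewrite [RHS]big_mkcond /=; apply: eq_bigr => l _; case: ifPn => lS; last first.
  rewrite big1 // => a _; rewrite big1 // => b _.
  by rewrite /edge_par /= !zE (negPf lS) !andbF !addbF Phi0.
rewrite -(@sum_star R n i (fun a b => (fun o : bool => Phi (bernw (if o then p l else q l)) (bernw (if o then q l else p l)))
      (zl l a == zl l b))); last by move=> a b; rewrite eq_sym.
apply: eq_bigr => a _; apply: eq_bigr => b ab; rewrite /edge_par /= !zE lS !andbT.
case: (boolP ((a == i) || (b == i))); last by case/norP => /negPf-> /negPf->; rewrite !addbF Phi0.
have : ~~ ((a == i) && (b == i)).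
  by apply/negP => /andP[/eqP ai /eqP bi]; move: ab; rewrite ai bi ltnn.
by case: (a == i); case: (b == i) => //= _ _; case: (zl l a); case: (zl l b).
Qed.

(** Star sums are compared with their values when half of the nodes agree with [i]. The coefficient
    6 is 4 from the bias of the tilted mean plus 2 from the log-normaliser. *)
Lemma sum_min_adj_prob (R : realType) (n L : nat) (p q : nat -> R) (C : R) (S : {set 'I_L})
    (i : 'I_n) (zl zl' : 'I_L -> 'I_n -> bool) (t x kappa : R) :
  let y := n%:R / 2 * \sum_(l in S)
     (tiltE t (bernw (p l)) (bernw (q l)) + tiltE t (bernw (q l)) (bernw (p l))) in
  sparse L C p q ->
  (forall l j, zl' l j = zl l j (+) ((j == i) && (l \in S))) ->
  0 <= t <= 1 -> 0 < kappa -> y = x \/ t = 0 /\ y <= x ->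
  expR (t * x - n%:R / 2 * (\sum_(l in S) Iinfo (p l) (q l) t)
        - kappa * (2 * C + 2) * n%:R * (\sum_(l in S) chi2 p q l) - (4 * kappa)^-1
        - \sum_(l in S) 6 * chi2 p q l * (2 + `|\sum_j spin R (zl l j)|))
  <= \sum_A Num.min (adj_prob p q zl A) (expR x * adj_prob p q zl' A).
Proof.
move=> y sp zE t01 k0 yx.
have pq l : (l < L)%N -> 0 < p l < 1 /\ 0 < q l < 1.
  by move=> /sp[q0 qp p2 _]; split; lra.
have P0 zz (k : edge n L) b : 0 < bernw (edge_par p q zz (val k)) b.
  have [pl ql] := pq _ (ltn_ord (val k).1.1).
  by apply: bernw_gt0; rewrite /edge_par; case: ifP.
apply: (@le_trans _ _ (\sum_(B : {ffun edge n L -> bool})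
    Num.min (adj_prob p q zl (sym_obs B)) (expR x * adj_prob p q zl' (sym_obs B)))); last first.
  apply: (@ler_sum_inj R _ _ (@sym_obs n L) (fun A => Num.min (adj_prob p q zl A) (expR x * adj_prob p q zl' A)) (@sym_obs_inj n L)).
  move=> A; rewrite le_min adj_prob_ge0 // mulr_ge0 ?expR_ge0 //; exact: adj_prob_ge0.
under [X in _ <= X]eq_bigr do rewrite !adj_prob_sym_obs.
apply: le_trans (sum_min_tilt (P0 zl) (P0 zl') t01 k0 yx).
rewrite ler_expR.
rewrite (@sum_edge_star R n L p q S i zl zl' (fun u v => ln (tiltZ t u v)) zE); last first.
  by move=> a; rewrite tiltZ_same ?ln1 // sum_bernw.
rewrite (@sum_edge_star R n L p q S i zl zl' (tiltE t) zE); last by move=> a; exact: tiltE_same.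
rewrite (@sum_edge_star R n L p q S i zl zl' (tiltV t) zE); last by move=> a; exact: tiltV_same.
have chiC a : (q a - p a) ^+ 2 / q a = chi2 p q a by rewrite /chi2 -sqrrN opprB.
have HV : \sum_(l in S) \sum_(j | j != i)
    (fun o : bool => tiltV t (bernw (if o then p l else q l)) (bernw (if o then q l else p l)))
      (zl l i == zl l j) <= (2 * C + 2) * n%:R * (\sum_(l in S) chi2 p q l).
  rewrite mulr_sumr; apply: ler_sum => l _.
  have [q0 qp p2 pC] := sp l (ltn_ord l).
  have c0 : 0 <= (2 * C + 2) * chi2 p q l.
    rewrite mulr_ge0 ?divr_ge0 ?sqr_ge0 ?(ltW q0) //.
    have : 0 < C * q l by lra.
    rewrite pmulr_lgt0 //; lra.
  apply: (@le_trans _ _ (\sum_(j : 'I_n) (2 * C + 2) * chi2 p q l)); last first.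
    by rewrite sumr_const card_ord -[_ *+ n]mulr_natl mulrA [n%:R * _]mulrC.
  rewrite big_mkcond /=; apply: ler_sum => j _; case: ifP => // _.
  case: ifP => _; first by apply: tiltV_bernw_le; lra.
  by rewrite -chiC; apply: tiltV_bernw_le; lra.
have HE : `|\sum_(l in S) \sum_(j | j != i)
    (fun o : bool => tiltE t (bernw (if o then p l else q l)) (bernw (if o then q l else p l)))
      (zl l i == zl l j) - y| <= \sum_(l in S) 4 * chi2 p q l * (2 + `|\sum_j spin R (zl l j)|).
  rewrite /y mulr_sumr -sumrB; rewrite (le_trans (ler_norm_sum _ _ _)) //.
  apply: ler_sum => l _; have [q0 qp p2 pC] := sp l (ltn_ord l).
  apply: (@sum_spin_orient R n i (zl l) (fun o : bool => tiltE t (bernw (if o then p l else q l)) (bernw (if o then q l else p l)))).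
  by case; [|rewrite -chiC]; apply: tiltE_bernw_le; lra.
have HZ : - (n%:R / 2 * (\sum_(l in S) Iinfo (p l) (q l) t))
    - \sum_(l in S) 2 * chi2 p q l * (2 + `|\sum_j spin R (zl l j)|)
  <= \sum_(l in S) \sum_(j | j != i)
    (fun o : bool => ln (tiltZ t (bernw (if o then p l else q l)) (bernw (if o then q l else p l))))
      (zl l i == zl l j).
  rewrite mulr_sumr -sumrN -sumrB; apply: ler_sum => l _; have [q0 qp p2 pC] := sp l (ltn_ord l).
  have [pl ql] := pq l (ltn_ord l).
  have := @sum_spin_orient R n i (zl l) (fun o : bool => ln (tiltZ t (bernw (if o then p l else q l)) (bernw (if o then q l else p l)))) (2 * chi2 p q l).
  rewrite Iinfo_tiltZ //= ler_norml => H.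
  have /H/andP[] : forall o : bool, `|ln (tiltZ t (bernw (if o then p l else q l)) (bernw (if o then q l else p l)))| <= 2 * chi2 p q l.
    by case; [|rewrite -chiC]; apply: ln_tiltZ_bernw_le; lra.
  lra.
have -> : \sum_(l in S) 6 * chi2 p q l * (2 + `|\sum_j spin R (zl l j)|) =
  \sum_(l in S) 4 * chi2 p q l * (2 + `|\sum_j spin R (zl l j)|) +
  \sum_(l in S) 2 * chi2 p q l * (2 + `|\sum_j spin R (zl l j)|).
  by rewrite -big_split /=; apply: eq_bigr => l _; lra.
move: HZ HE (ler_wpM2l (ltW k0) HV); rewrite !mulrA.
set s1 := \sum_(l in S) \sum_(j | _) _.
set s2 := `| _ - y|.
set s3 := kappa * \sum_(l in S) _.
lra.
Qed.

(** * The information quantities *)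

Lemma continuous_sum_tiltE (R : realType) (I : finType) (S : {pred I}) (u v : I -> bool -> R) (c : R) :
  (forall i b, i \in S -> 0 < u i b) -> (forall i b, i \in S -> 0 < v i b) ->
  continuous (fun t => c * \sum_(i in S) (tiltE t (u i) (v i) + tiltE t (v i) (u i))).
Proof.
move=> u0 v0.
have cs : continuous (fun t => \sum_(i in S) (tiltE t (u i) (v i) + tiltE t (v i) (u i))).
  apply: (@continuous_big _ _ +%R 0 _ _ _ _ (fun i t => tiltE t (u i) (v i) + tiltE t (v i) (u i))).
    exact: add_continuous.
  move=> i iS t; apply: continuousD; first by apply: continuous_tiltE => b; exact: u0.
  by apply: continuous_tiltE => b; exact: v0.
by move=> t; apply: continuousM; [exact: cst_continuous|exact: cs].
Qed.

Lemma exists_tilt (R : realType) (n L : nat) (C : R) (p q : nat -> R) (S : {set 'I_L}) (x : R) :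
  sparse L C p q -> 0 <= x ->
  let y t := n%:R / 2 * \sum_(l in S)
     (tiltE t (bernw (p l)) (bernw (q l)) + tiltE t (bernw (q l)) (bernw (p l))) in
  exists t, 0 <= t <= 1 /\ (y t = x \/ t = 0 /\ y t <= x).
Proof.
move=> sp x0 y; have [y0x|xy0] := leP (y 0) x.
  by exists 0; rewrite lexx ler01; split => //; right.
have p0 (l : 'I_L) b : 0 < bernw (p l) b.
  by have [q0 qp p2 _] := sp l (ltn_ord l); apply: bernw_gt0; lra.
have q0 (l : 'I_L) b : 0 < bernw (q l) b.
  by have [? qp p2 _] := sp l (ltn_ord l); apply: bernw_gt0; lra.
have y2 : y (1 / 2) = 0.
  rewrite /y big1 ?mulr0 // => l _.
  by rewrite (@tiltE_half_anti _ (bernw (p l))) ?subrr.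
have cy : continuous y.
  exact: (@continuous_sum_tiltE R 'I_L (mem S) (fun l => bernw (p l)) (fun l => bernw (q l)) (n%:R / 2)).
have h0 : (0 : R) <= 1 / 2 by lra.
have [|t] := @IVT R y 0 (1 / 2) x h0 (continuous_subspaceT cy).
  by rewrite ge_min le_max y2 x0 (ltW xy0) orbT.
by rewrite in_itv /= => /andP[t0 t1] yt; exists t; split; [lra|left].
Qed.

Lemma chi2_ge0 (R : realType) (L : nat) (C : R) (p q : nat -> R) (l : 'I_L) :
  sparse L C p q -> 0 <= chi2 p q l.
Proof. by move=> /(_ l (ltn_ord l))[q0 _ _ _]; rewrite divr_ge0 ?sqr_ge0 ?ltW. Qed.

Lemma Iinfo_le (R : realType) (L : nat) (C : R) (p q : nat -> R) (l : 'I_L) (t : R) :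
  sparse L C p q -> 0 <= t <= 1 -> Iinfo (p l) (q l) t <= 4 * chi2 p q l.
Proof.
move=> /(_ l (ltn_ord l))[q0 qp p2 _] t01.
rewrite Iinfo_tiltZ; try lra.
have hp : q l <= p l <= 1 / 2 by lra.
have hq : q l <= q l <= 1 / 2 by lra.
have := ln_tiltZ_bernw_le t01 q0 hp hq; have := ln_tiltZ_bernw_le t01 q0 hq hp.
rewrite -[(q l - p l) ^+ 2]sqrrN opprB -/(chi2 p q l) => A B.
have nb a b : `|a| <= b -> - a <= b :> R by rewrite -normrN; exact: le_trans (ler_norm _).
have := nb _ _ A; have := nb _ _ B; lra.
Qed.

Lemma Iinfo0 (R : realType) (p q : R) : 0 < p < 1 -> 0 < q < 1 -> Iinfo p q 0 = 0.
Proof.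
move=> p01 q01; rewrite Iinfo_tiltZ //.
have Z0 a b : tiltZ 0 (bernw a) (bernw b) = 1 :> R.
  by rewrite -[RHS](sum_bernw a); apply: eq_bigr => x _; rewrite oppr0 mul0r expR0 mulr1.
by rewrite !Z0 ln1 addr0 oppr0.
Qed.

Lemma psiS_star_ge (R : realType) (n L : nat) (C : R) (p q : nat -> R) (S : {set 'I_L}) (a t : R) :
  sparse L C p q -> a <= 0 -> 0 <= t <= 1 ->
  a * t + n%:R / 2 * (\sum_(l in S) Iinfo (p l) (q l) t) <= psiS_star n p q S a.
Proof.
move=> sp a0 t01; apply: ub_le_sup.
  (* The supremum dominates its members only once the set is known to be bounded above; [a * t <= 0]
     and [Iinfo_le] give the bound. *)
  exists (n%:R / 2 * \sum_(l in S) 4 * chi2 p q l) => _ /= [s s01 <-].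
  rewrite in_itv /= in s01; have [s0 s1] := andP s01.
  rewrite /psiS mulNr opprK.
  apply: (@le_trans _ _ (0 + n%:R / 2 * (\sum_(l in S) Iinfo (p l) (q l) s))).
    by rewrite lerD2r mulr_le0_ge0.
  rewrite add0r ler_wpM2l ?divr_ge0 //; apply: ler_sum => l _; exact: (Iinfo_le _ sp).
exists t; first by rewrite /= in_itv.
by rewrite /psiS mulNr opprK.
Qed.

Lemma psiS_star_ge0 (R : realType) (n L : nat) (C : R) (p q : nat -> R) (S : {set 'I_L}) (a : R) :
  sparse L C p q -> a <= 0 -> 0 <= psiS_star n p q S a.
Proof.
move=> sp a0; have t0 : 0 <= (0 : R) <= 1 by rewrite lexx ler01.
apply: le_trans (@psiS_star_ge R n L C p q S a 0 sp a0 t0).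
rewrite mulr0 add0r big1 ?mulr0 // => l _.
by have [q0 qp p2 _] := sp l (ltn_ord l); rewrite Iinfo0 //; lra.
Qed.

Lemma expR_Jrho (R : realType) (rho : R) : 0 < rho < 1 / 2 ->
  expR (- Jrho rho) = 2 * Num.sqrt (rho * (1 - rho)).
Proof.
move=> r01; rewrite /Jrho opprK lnK // posrE mulr_gt0 // sqrtr_gt0 mulr_gt0 //; lra.
Qed.

Lemma Jrho_ge0 (R : realType) (rho : R) : 0 < rho < 1 / 2 -> 0 <= Jrho rho.
Proof.
move=> r01; rewrite -oppr_le0 -ler_expR expR0 expR_Jrho //.
have r0 : 0 <= rho * (1 - rho) by rewrite mulr_ge0; lra.
have s0 := sqrtr_ge0 (rho * (1 - rho)).
have := sqr_sqrtr r0; have := sqr_ge0 (2 * rho - 1); nra.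
Qed.

(* Even and odd [|S^c|] are treated uniformly: [|S^c| + odd |S^c|] noisy labels, and threshold
   [x = 2 J] (odd case) or [x = 0] (even case) for the log-likelihood ratio. *)
Definition evenup (m : nat) : nat := m + odd m.
Definition thr (R : realType) (m : nat) (rho : R) : R := if odd m then 2 * Jrho rho else 0.

Lemma thr_ge0 (R : realType) (m : nat) (rho : R) : 0 < rho < 1 / 2 -> 0 <= thr m rho.
Proof. by move=> /Jrho_ge0 J0; rewrite /thr; case: ifP => // _; rewrite mulr_ge0. Qed.

Lemma calIE (R : realType) (n L : nat) (rho : R) (p q : nat -> R) (S : {set 'I_L}) :
  calI n rho p q S =
  (evenup #|~: S|)%:R * Jrho rho + psiS_star n p q S (- thr #|~: S| rho).
Proof.
rewrite /calI /evenup /thr; case: ifP => _; first by rewrite addn1 mulNr.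
by rewrite addn0 oppr0.
Qed.

Lemma calI_ge_noise (R : realType) (n L : nat) (C rho : R) (p q : nat -> R) (S : {set 'I_L}) :
  sparse L C p q -> 0 < rho < 1 / 2 ->
  (evenup #|~: S|)%:R * Jrho rho <= calI n rho p q S.
Proof.
move=> sp r01; rewrite calIE lerDl; apply: (psiS_star_ge0 _ _ sp).
by rewrite oppr_le0 thr_ge0.
Qed.

Lemma calI_ge0 (R : realType) (n L : nat) (C rho : R) (p q : nat -> R) (S : {set 'I_L}) :
  sparse L C p q -> 0 < rho < 1 / 2 -> 0 <= calI n rho p q S.
Proof.
move=> sp r01; apply: le_trans (calI_ge_noise n S sp r01).
by rewrite mulr_ge0 ?Jrho_ge0.
Qed.

(** Evaluate the conjugate at [t = 1 / 2]. In the odd case this loses one [Jrho rho], which the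
    noise term, containing at least one, makes up for. *)
Lemma calI_ge_chi2 (R : realType) (n L : nat) (C rho : R) (p q : nat -> R) (S : {set 'I_L}) :
  0 <= C -> sparse L C p q -> 0 < rho < 1 / 2 ->
  n%:R * (\sum_(l in S) chi2 p q l) <= 8 * C * calI n rho p q S.
Proof.
move=> C0 sp r01; have J0 := Jrho_ge0 r01.
have x0 : - thr #|~: S| rho <= 0 by rewrite oppr_le0 thr_ge0.
have h01 : 0 <= (1 / 2 : R) <= 1 by lra.
apply: (@le_trans _ _ (8 * C * (n%:R / 2 * (\sum_(l in S) Iinfo (p l) (q l) (1 / 2))))).
  rewrite !mulr_sumr; apply: ler_sum => l _.
  have [q0 qp p2 pC] := sp l (ltn_ord l).
  have -> : 8 * C * (n%:R / 2 * Iinfo (p l) (q l) (1 / 2)) = n%:R * (4 * C * Iinfo (p l) (q l) (1 / 2)) by field.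
  by rewrite ler_wpM2l // Iinfo_half_ge.
rewrite ler_wpM2l ?mulr_ge0 //.
have : (odd #|~: S|)%:R * Jrho rho <= (evenup #|~: S|)%:R * Jrho rho.
  by rewrite ler_wpM2r // ler_nat /evenup leq_addl.
have := @psiS_star_ge R n L C p q S _ _ sp x0 h01; rewrite calIE.
rewrite /thr; case: (odd _) => /= h1 h2; lra.
Qed.

(** * Coupling the label noise *)

Definition obs_prob (R : realType) (n L : nat) (rho : R) (p q : nat -> R)
  (z : labels n) (A : obs n L) : R :=
  \sum_(xi : noise n L) noise_prob rho xi * adj_prob p q (layer_label z xi) A.

Definition flip_at (n : nat) (i : 'I_n) (z : labels n) : labels n :=
  [ffun j => z j (+) (j == i)].

Lemma subset_card_exists (T : finType) (A : {set T}) (k : nat) :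
  (k <= #|A|)%N -> exists2 B : {set T}, B \subset A & #|B| = k.
Proof.
move=> kA; have : (0 < 'C(#|A|, k))%N by rewrite bin_gt0.
rewrite -cards_draws card_gt0 => /set0Pn[B]; rewrite inE => /andP[BA /eqP Bk].
by exists B.
Qed.

Definition pinned (n L : nat) (i : 'I_n) (S : {set 'I_L}) (k : 'I_L * 'I_n) : bool :=
  (k.2 == i) && (k.1 \notin S).

(* The noise law conditioned on the flips of node [i] in the layers outside [S] being exactly [T]. *)
Definition pinw (R : realType) (n L : nat) (rho : R) (i : 'I_n) (S T : {set 'I_L})
    (k : 'I_L * 'I_n) (b : bool) : R :=
  if pinned i S k then (b == (k.1 \in T))%:R else bernw rho b.

Lemma pinw_ge0 (R : realType) (n L : nat) (rho : R) (i : 'I_n) (S T : {set 'I_L}) k b :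
  0 < rho < 1 -> 0 <= pinw rho i S T k b.
Proof. by move=> r01; rewrite /pinw; case: ifP => // _; apply/ltW/bernw_gt0. Qed.

Lemma sum_pinw (R : realType) (n L : nat) (rho : R) (i : 'I_n) (S T : {set 'I_L}) k :
  \sum_b pinw rho i S T k b = 1.
Proof.
rewrite /pinw; case: (pinned i S k); last exact: sum_bernw.
by rewrite big_bool /=; case: (k.1 \in T); rewrite /= ?addr0 ?add0r.
Qed.

Lemma prod_pinned (R : realType) (n L : nat) (i : 'I_n) (S T : {set 'I_L}) (u : bool -> R) :
  T \subset ~: S ->
  \prod_k (if pinned i S k then u (k.1 \in T) else 1) =
  u true ^+ #|T| * u false ^+ (#|~: S| - #|T|).
Proof.
move=> TS; transitivity (\prod_(l : 'I_L) \prod_(j : 'I_n)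
  (if (j == i) && (l \notin S) then u (l \in T) else 1)).
  by rewrite pair_big.
transitivity (\prod_(l in ~: S) u (l \in T)).
  rewrite [RHS]big_mkcond; apply: eq_bigr => l _; rewrite inE.
  rewrite (bigD1 i) //= eqxx /= big1 ?mulr1; last by move=> j /negPf->.
  by [].
rewrite (finset.big_setID T) /= (finset.setIidPr TS).
rewrite (eq_bigr (fun=> u true)); last by move=> l ->.
rewrite [X in _ * X](eq_bigr (fun=> u false)); last by move=> l; rewrite inE => /andP[/negPf->].
by rewrite !prodr_const cardsD (finset.setIidPr TS).
Qed.

(** Noise that agrees with [T] on the pinned coordinates has exactly the left-hand weight; any other
    noise has conditional weight 0. *)
Lemma noise_prob_ge (R : realType) (n L : nat) (rho : R) (i : 'I_n) (S T : {set 'I_L})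
    (xi : noise n L) : 0 < rho < 1 -> T \subset ~: S ->
  rho ^+ #|T| * (1 - rho) ^+ (#|~: S| - #|T|) * prodw (pinw rho i S T) xi <= noise_prob rho xi.
Proof.
move=> r01 TS; have := @prod_pinned R n L i S T (bernw rho) TS; rewrite /bernw /bern => <-.
rewrite /prodw -big_split /=; apply: ler_prod => k _.
have b0 b := ltW (@bernw_gt0 R rho b r01).
rewrite /pinw; case: ifP => _; last by rewrite mul1r b0 lexx.
have := b0 (k.1 \in T); rewrite /bernw /bern => H.
by case: eqVneq => [->|_]; rewrite ?mulr1 ?mulr0 ?lexx ?H //=; exact: (b0 (xi k)).
Qed.

(** Outside [S] this cancels a flip of node [i] in the global labels; inside [S] the global flip
    stays visible. *)
Definition flip_noise (n L : nat) (i : 'I_n) (S : {set 'I_L}) (xi : noise n L) : noise n L :=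
  [ffun k => xi k (+) pinned i S k].

Lemma flip_noiseK (n L : nat) (i : 'I_n) (S : {set 'I_L}) : involutive (@flip_noise n L i S).
Proof. by move=> xi; apply/ffunP => k; rewrite !ffunE addbK. Qed.

Lemma noise_prob_flip_ge (R : realType) (n L : nat) (rho : R) (i : 'I_n) (S T : {set 'I_L})
    (xi : noise n L) : 0 < rho < 1 -> T \subset ~: S ->
  (1 - rho) ^+ #|T| * rho ^+ (#|~: S| - #|T|) * prodw (pinw rho i S T) xi
    <= noise_prob rho (flip_noise i S xi).
Proof.
move=> r01 TS; have := @prod_pinned R n L i S T (fun b => bernw rho (~~ b)) TS.
rewrite /bernw /bern /= => <-.
rewrite /prodw -big_split /=; apply: ler_prod => k _.
have b0 b := ltW (@bernw_gt0 R rho b r01).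
rewrite /pinw ffunE; case: ifP => _; last by rewrite mul1r addbF b0 lexx.
have := b0 (~~ (k.1 \in T)); rewrite /bernw /bern => H.
by case: eqVneq => [->|_]; rewrite ?addbT ?mulr1 ?mulr0 ?lexx ?H //=; exact: (b0 (~~ xi k)).
Qed.

(** [G] is (rho(1-rho))^k with k = [uphalf m] and 2k = [evenup m]. For odd [m] the second weight has
    one factor [rho] fewer, which absorbs e^(2J) = 1/(4 rho(1-rho)) because 1 - rho >= 1/4. *)
Lemma pattern_weight_ge (R : realType) (rho : R) (m : nat) : 0 < rho < 1 / 2 ->
  let G := expR (- ((evenup m)%:R * Jrho rho + (evenup m)%:R * ln 2)) in
  G <= rho ^+ uphalf m * (1 - rho) ^+ (m - uphalf m) /\
  expR (thr m rho) * G <= (1 - rho) ^+ uphalf m * rho ^+ (m - uphalf m).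
Proof.
move=> r01 G; set k := uphalf m.
have r1 : 0 <= rho * (1 - rho) by rewrite mulr_ge0; lra.
have J2 : expR (- Jrho rho - ln 2) ^+ 2 = rho * (1 - rho).
  rewrite expRD expR_Jrho // expRN lnK ?posrE //.
  rewrite [2 * _]mulrC mulfK // sqr_sqrtr //.
have mk : evenup m = (k * 2)%N.
  by rewrite /evenup /k uphalf_half -{1}(odd_double_half m) -muln2; case: odd; lia.
have GE : G = (rho * (1 - rho)) ^+ k.
  rewrite -J2 -exprM mulnC -mk -expRM_natl; congr expR; ring.
have mE : (m - k)%N = if odd m then k.-1 else k.
  by rewrite /k uphalf_half -{1}(odd_double_half m) -muln2; case: odd; lia.
rewrite GE exprMn; split.
  rewrite ler_wpM2l ?exprn_ge0 //; first lra.
  by apply: ler_wiXn2l; [lra|lra|rewrite mE; case: ifP => // _; exact: leq_pred].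
rewrite mE /thr; case: ifP => om; last by rewrite expR0 mul1r mulrC.
have k0 : (0 < k)%N by rewrite /k uphalf_half om.
case: k k0 {mk GE mE} => // k _ /=.
rewrite !exprS.
have E2 : expR (2 * Jrho rho) * (4 * (rho * (1 - rho))) = 1.
  have -> : 4 * (rho * (1 - rho)) = expR (- Jrho rho) ^+ 2.
    by rewrite expR_Jrho // exprMn sqr_sqrtr //; ring.
  by rewrite -expRM_natl -expRD -[RHS]expR0; congr expR; ring.
have -> : expR (2 * Jrho rho) * (rho * rho ^+ k * ((1 - rho) * (1 - rho) ^+ k)) =
   (expR (2 * Jrho rho) * (4 * (rho * (1 - rho)))) * (1 / 4) * ((1 - rho) ^+ k * rho ^+ k) by field.
rewrite E2 mul1r -[leRHS]mulrA ler_wpM2r ?mulr_ge0 ?exprn_ge0 //; lra.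
Qed.

Lemma layer_label_flip (n L : nat) (i : 'I_n) (S : {set 'I_L}) (z : labels n) (xi : noise n L) l j :
  layer_label (flip_at i z) (flip_noise i S xi) l j =
  layer_label z xi l j (+) ((j == i) && (l \in S)).
Proof.
rewrite /layer_label !ffunE /pinned /=.
by case: (j == i); case: (l \in S); case: (z j); case: (xi (l, j)).
Qed.

(* Two hypotheses differing at node [i] are coupled by sharing the noise in the layers of [S] and
   having opposite flips of node [i] elsewhere, so that the labels outside [S] agree. *)
Lemma sum_min_obs_prob_ge (R : realType) (n L : nat) (C rho kappa : R) (p q : nat -> R)
    (S : {set 'I_L}) (i : 'I_n) (z : labels n) :
  sparse L C p q -> 0 < rho < 1 / 2 -> 0 < kappa ->
  expR (- (calI n rho p q S + (evenup #|~: S|)%:R * ln 2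
     + kappa * (2 * C + 2) * (n%:R * (\sum_(l in S) chi2 p q l)) + (4 * kappa)^-1
     + 6 * (\sum_(l in S) chi2 p q l) * (2 + `|\sum_j spin R (z j)| + 2 * (n%:R * rho))))
  <= \sum_(A : obs n L) Num.min (obs_prob rho p q z A) (obs_prob rho p q (flip_at i z) A).
Proof.
move=> sp r01 k0; have r1 : 0 < rho < 1 by lra.
have [T TS cT] : exists2 T : {set 'I_L}, T \subset ~: S & #|T| = uphalf #|~: S|.
  by apply: subset_card_exists; rewrite leq_uphalf_double -addnn leq_addr.
set m := #|~: S| in cT *.
set G := expR (- ((evenup m)%:R * Jrho rho + (evenup m)%:R * ln 2)).
have [G1 G2] := pattern_weight_ge m r01; rewrite -/G in G1 G2.
set x := thr m rho in G2 *.
have x0 : 0 <= x by exact: thr_ge0.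
set w := pinw rho i S T.
have w0 k b : 0 <= w k b by exact: pinw_ge0.
have w1 k : \sum_b w k b = 1 by exact: sum_pinw.
have pq l : (l < L)%N -> 0 < p l < 1 /\ 0 < q l < 1.
  by move=> /sp[q0 qp p2 _]; split; lra.
have [t [t01 yt]] := exists_tilt n S sp x0.
pose zl xi := layer_label z xi : 'I_L -> 'I_n -> bool.
pose zl' xi := layer_label (flip_at i z) (flip_noise i S xi) : 'I_L -> 'I_n -> bool.
(* Keeping only the pattern [T] bounds both marginals below by [G] times mixtures over the same law
   [w], the second with the extra factor [expR x]. *)
have O1 A : G * \sum_xi prodw w xi * adj_prob p q (zl xi) A <= obs_prob rho p q z A.
  rewrite mulr_sumr; apply: ler_sum => xi _; rewrite mulrA.
  apply: ler_wpM2r; first exact: adj_prob_ge0.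
  apply: le_trans (noise_prob_ge i xi r1 TS).
  by rewrite ler_wpM2r ?prodw_ge0 // cT.
have O2 A : G * \sum_xi expR x * (prodw w xi * adj_prob p q (zl' xi) A) <= obs_prob rho p q (flip_at i z) A.
  rewrite /obs_prob [leRHS](reindex_inj (inv_inj (@flip_noiseK n L i S))) /=.
  rewrite mulr_sumr; apply: ler_sum => xi _.
  have -> (a b d e : R) : a * (b * (d * e)) = b * a * d * e by ring.
  apply: ler_wpM2r; first exact: adj_prob_ge0.
  apply: le_trans (noise_prob_flip_ge i xi r1 TS).
  by rewrite ler_wpM2r ?prodw_ge0 // cT.
pose c := t * x - n%:R / 2 * (\sum_(l in S) Iinfo (p l) (q l) t)
        - kappa * (2 * C + 2) * n%:R * (\sum_(l in S) chi2 p q l) - (4 * kappa)^-1.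
pose H (xi : noise n L) := c - \sum_(l in S) 6 * chi2 p q l * (2 + `|\sum_j spin R (z j)| + 2 * \sum_j (xi (l, j))%:R).
have E1 xi : expR (H xi) <= \sum_A Num.min (adj_prob p q (zl xi) A) (expR x * adj_prob p q (zl' xi) A).
  apply: le_trans (@sum_min_adj_prob R n L p q C S i (zl xi) (zl' xi) t x kappa sp _ t01 k0 yt); last first.
    by move=> l j; exact: layer_label_flip.
  rewrite ler_expR /H -/c lerD2l lerN2; apply: ler_sum => l _.
  have c0 := chi2_ge0 l sp.
  apply: ler_wpM2l; first by lra.
  have := @spin_flip_le R n z (fun j => xi (l, j)); rewrite /zl /layer_label; lra.
(* In a layer of [S] no flip is pinned, so the expected number of flips is [n%:R * rho]. *)
have EH : \sum_xi prodw w xi * H xi =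
  c - 6 * (\sum_(l in S) chi2 p q l) * (2 + `|\sum_j spin R (z j)| + 2 * (n%:R * rho)).
  transitivity (\sum_xi (c * prodw w xi - \sum_(l in S) (6 * chi2 p q l * (2 + `|\sum_j spin R (z j)|) * prodw w xi
     + \sum_j 12 * chi2 p q l * (prodw w xi * (xi (l, j))%:R)))).
    apply: eq_bigr => xi _; rewrite /H mulrBr [c * _]mulrC; congr (_ - _).
    rewrite mulr_sumr; apply: eq_bigr => l _.
    rewrite -[\sum_j 12 * _ * _]mulr_sumr -[\sum_j prodw w xi * _]mulr_sumr; ring.
  rewrite sumrB -mulr_sumr sum_prodw // mulr1; congr (_ - _).
  rewrite exchange_big /= -[6 * _ * _]mulrA mulrCA mulr_suml; apply: eq_bigr => l lS.
  rewrite big_split /= -mulr_sumr sum_prodw // mulr1 exchange_big /=.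
  have -> : \sum_(j < n) \sum_xi 12 * chi2 p q l * (prodw w xi * (xi (l, j))%:R) = \sum_(j < n) 12 * chi2 p q l * rho.
    apply: eq_bigr => j _; rewrite -mulr_sumr; congr (_ * _).
    rewrite (@sum_prodw_coord R _ w (l, j) (fun b => b%:R)) // big_bool /= mulr0 addr0 mulr1.
    by rewrite /w /pinw /pinned /= lS andbF.
  rewrite sumr_const card_ord -[_ *+ n]mulr_natl; ring.
(* Jensen again, now over the noise. The chosen [t] is one candidate in the supremum defining
   [psiS_star], which therefore bounds the exponent. *)
apply: (@le_trans _ _ (G * \sum_xi prodw w xi * expR (H xi))).
  apply: le_trans (ler_wpM2l (expR_ge0 _) (expR_jensen H (fun xi => prodw_ge0 xi w0) (sum_prodw w1))).
  rewrite EH -expRD ler_expR calIE -/m -/x.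
  have nx : - x <= 0 by rewrite oppr_le0.
  have := psiS_star_ge n S sp nx t01; rewrite /c; lra.
apply: (@le_trans _ _ (G * \sum_xi \sum_A prodw w xi * Num.min (adj_prob p q (zl xi) A) (expR x * adj_prob p q (zl' xi) A))).
  rewrite ler_wpM2l ?expR_ge0 //; apply: ler_sum => xi _.
  by rewrite -[leRHS]mulr_sumr; apply: ler_wpM2l; [exact: prodw_ge0|exact: E1].
rewrite exchange_big mulr_sumr /=; apply: ler_sum => A _; rewrite le_min; apply/andP; split.
  apply: le_trans (O1 A); rewrite ler_wpM2l ?expR_ge0 //; apply: ler_sum => xi _.
  by apply: ler_wpM2l; [exact: prodw_ge0|rewrite ge_min lexx].
apply: le_trans (O2 A); rewrite ler_wpM2l ?expR_ge0 //; apply: ler_sum => xi _.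
by rewrite [leRHS]mulrCA; apply: ler_wpM2l; [exact: prodw_ge0|rewrite ge_min lexx orbT].
Qed.

(** * From testing to the minimax risk *)

Lemma card_mkset (T : finType) (P : pred T) : #|[set x | P x]%classic| = #|[set x | P x]%SET|.
Proof. by apply: eq_card => x; rewrite finset.inE; apply/idP/idP; rewrite in_setE. Qed.

(** Nodes below [h] are free and the others alternate in sign, which keeps the classes nearly
    balanced. *)
Definition pinned_labels (n h : nat) : {set labels n} :=
  [set z : labels n | [forall j : 'I_n, (h <= j)%N ==> (z j == odd j)]].

Lemma pinned_labelsP (n h : nat) (z : labels n) :
  reflect (forall j : 'I_n, (h <= j)%N -> z j = odd j) (z \in pinned_labels n h).
Proof.
rewrite inE; apply: (iffP forallP) => H j; first by move=> hj; apply/eqP/(implyP (H j)).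
by apply/implyP => hj; apply/eqP/H.
Qed.

(* The sign of an estimate is only identified by its majority agreement with the pinned nodes. *)
Definition align (n h : nat) (zh : labels n) : labels n :=
  if (2 * #|[set j : 'I_n | (h <= j)%N && (zh j != odd j)]%SET| <= n - h)%N then zh
  else [ffun i => ~~ zh i].

Lemma card_ord_lt (n h : nat) : (h <= n)%N -> #|[set i : 'I_n | (i < h)%N]%SET| = h.
Proof.
move=> hn; rewrite -sum1dep_card (big_ord_narrow hn) sum_nat_const card_ord muln1 //.
Qed.

(** For the sign chosen by [align] the errors on free nodes are part of all errors. The opposite
    sign errs on at least half of the [n - h] pinned nodes, which is at least [h] since
    [3 * h <= n]. *)
Lemma hamming_align_ge (n h : nat) (zh z : labels n) : (3 * h <= n)%N ->
  z \in pinned_labels n h ->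
  (#|[set i : 'I_n | (i < h)%N && (align h zh i != z i)]%SET| <=
    minn (hamming zh z) (hamming [ffun i => ~~ zh i] z))%N.
Proof.
move=> h3 /pinned_labelsP zP; have hn : (h <= n)%N by lia.
pose Lo := [set i : 'I_n | (i < h)%N]%SET; pose X := [set i | zh i != z i]%SET.
have cLo : #|Lo| = h by exact: card_ord_lt.
have eX : hamming zh z = #|X| by exact: card_mkset.
have eXC : hamming [ffun i => ~~ zh i] z = #|~: X|.
  rewrite /hamming card_mkset; apply: eq_card => i; rewrite !inE ffunE.
  by case: (zh i); case: (z i).
have e1 : #|[set j : 'I_n | (h <= j)%N && (zh j != odd j)]%SET| = #|X :\: Lo|.
  apply: eq_card => j; rewrite !inE -leqNgt; case: leqP => //= hj; by rewrite zP.
have e2 : #|[set i : 'I_n | (i < h)%N && (zh i != z i)]%SET| = #|X :&: Lo|.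
  by apply: eq_card => j; rewrite !inE andbC.
have e3 : #|[set i : 'I_n | (i < h)%N && ([ffun i => ~~ zh i] i != z i)]%SET| = #|Lo :\: X|.
  by apply: eq_card => j; rewrite !inE ffunE; case: (zh j); case: (z j); rewrite ?andbT ?andbF.
have k1 := cardsID Lo X; have k2 := cardsID X Lo; have k3 := cardsC X.
rewrite finset.setIC in k2; rewrite card_ord in k3.
have k4 : (#|Lo :|: X| <= n)%N by rewrite -[leqRHS]card_ord max_card.
have k5 := cardsUI Lo X; rewrite finset.setIC in k5.
rewrite leq_min eX eXC /align e1; case: ifP => H; rewrite ?e2 ?e3; lia.
Qed.

Lemma loss_align_ge (R : realType) (n h : nat) (zh z : labels n) : (3 * h <= n)%N ->
  z \in pinned_labels n h ->
  (\sum_(i : 'I_n | (i < h)%N) (align h zh i != z i)%:R) / n%:R <= loss R zh z.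
Proof.
move=> h3 zP; rewrite /loss ler_wpM2r ?invr_ge0 //.
apply: le_trans (_ : #|[set i : 'I_n | (i < h)%N && (align h zh i != z i)]%SET|%:R <= _); last first.
  by rewrite ler_nat hamming_align_ge.
rewrite -sum1dep_card natr_sum big_mkcondr /=.
by apply: ler_sum => i _; case: (_ != _).
Qed.

Lemma riskE (R : realType) (n L : nat) (rho : R) (p q : nat -> R) (f : obs n L -> labels n) z :
  risk rho p q f z = \sum_A obs_prob rho p q z A * loss R (f A) z.
Proof.
rewrite /risk /obs_prob.
under eq_bigr do rewrite mulr_sumr.
rewrite exchange_big; apply: eq_bigr => A _ /=; rewrite mulr_suml.
by apply: eq_bigr => xi _; rewrite mulrA.
Qed.

Lemma flip_atK (n : nat) (i : 'I_n) : involutive (flip_at i).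
Proof. by move=> z; apply/ffunP => j; rewrite !ffunE addbK. Qed.

Lemma flip_at_pinned (n h : nat) (i : 'I_n) (z : labels n) : (i < h)%N ->
  (flip_at i z \in pinned_labels n h) = (z \in pinned_labels n h).
Proof.
move=> ih.
have K y : y \in pinned_labels n h -> flip_at i y \in pinned_labels n h.
  move=> /pinned_labelsP H; apply/pinned_labelsP => j hj; rewrite ffunE H //.
  by case: eqVneq => [ji|]; rewrite ?addbF //; move: hj; rewrite ji leqNgt ih.
by apply/idP/idP; [move/K; rewrite flip_atK|exact: K].
Qed.

(** The two label vectors disagree at [i], so for every [A] exactly one of the two errors occurs. *)
Lemma test_error_ge (R : realType) (n L : nat) (rho : R) (p q : nat -> R)
    (f : obs n L -> labels n) (i : 'I_n) (z : labels n) :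
  (forall z A, 0 <= @obs_prob R n L rho p q z A) ->
  \sum_(A : obs n L) Num.min (obs_prob rho p q z A) (obs_prob rho p q (flip_at i z) A) <=
  \sum_A obs_prob rho p q z A * (f A i != z i)%:R +
  \sum_A obs_prob rho p q (flip_at i z) A * (f A i != flip_at i z i)%:R.
Proof.
move=> P0; rewrite -big_split /=; apply: ler_sum => A _.
rewrite ge_min ffunE eqxx addbT.
by case: (f A i); case: (z i); rewrite /= ?mulr0 ?mulr1 ?addr0 ?add0r lexx ?orbT.
Qed.

(** The supremum is at least the average over pinned labels. The involution [flip_at i] pairs these,
    so each free node errs with average probability at least [c / 2], and there are [h] free nodes
    out of [n]. *)
Lemma minimax_risk_ge (R : realType) (n L h : nat) (rho : R) (p q : nat -> R) (beta c : R) :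
  (forall z A, 0 <= @obs_prob R n L rho p q z A) -> (3 * h <= n)%N ->
  (forall z, z \in pinned_labels n h -> in_Pn beta z) ->
  (forall z (i : 'I_n), z \in pinned_labels n h ->
     c <= \sum_(A : obs n L) Num.min (obs_prob rho p q z A) (obs_prob rho p q (flip_at i z) A)) ->
  h%:R / (2 * n%:R) * c <= minimax_risk n L rho p q beta.
Proof.
move=> P0 h3 ZP pairc; have hn : (h <= n)%N by lia.
apply: lb_le_inf; first by eexists; exists (fun=> [ffun=> true]).
move=> _ [f _ <-].
set E := [set risk rho p q f z | z in _].
have rsup z : z \in pinned_labels n h -> risk rho p q f z <= sup E.
  move=> zP; apply: ub_le_sup; last by exists z => //; exact: ZP.
  exists (\sum_(y : labels n) `|risk rho p q f y|) => _ [y _ <-].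
  by rewrite (bigD1 y) //= (le_trans (ler_norm _)) // lerDl sumr_ge0.
have Zpos : (0 < #|pinned_labels n h|)%N.
  apply/card_gt0P; exists [ffun j : 'I_n => odd j]; apply/pinned_labelsP => j _.
  by rewrite ffunE.
pose u (i : 'I_n) z := \sum_A obs_prob rho p q z A * (align h (f A) i != z i)%:R.
have riskge z : z \in pinned_labels n h -> (\sum_(i : 'I_n | (i < h)%N) u i z) / n%:R <= risk rho p q f z.
  move=> zP; rewrite riskE /u exchange_big mulr_suml /=; apply: ler_sum => A _.
  by rewrite -mulr_sumr -mulrA ler_wpM2l // loss_align_ge.
have ui (i : 'I_n) : (i < h)%N -> #|pinned_labels n h|%:R * c / 2 <= \sum_(z in pinned_labels n h) u i z.
  move=> ih; rewrite ler_pdivrMr //.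
  have -> : (\sum_(z in pinned_labels n h) u i z) * 2 = \sum_(z in pinned_labels n h) (u i z + u i (flip_at i z)).
    rewrite mulrDr mulr1 big_split /=; congr (_ + _).
    rewrite (reindex_inj (inv_inj (@flip_atK n i))) /=.
    by apply: eq_bigl => z; rewrite flip_at_pinned.
  rewrite mulr_natl -sumr_const; apply: ler_sum => z zP.
  apply: le_trans (pairc z i zP) _.
  exact: (@test_error_ge R n L rho p q (fun A => align h (f A))).
have : \sum_(z in pinned_labels n h) ((\sum_(i : 'I_n | (i < h)%N) u i z) / n%:R) <= #|pinned_labels n h|%:R * sup E.
  rewrite mulr_natl -sumr_const; apply: ler_sum => z zP.
  exact: le_trans (riskge z zP) (rsup z zP).
rewrite -mulr_suml exchange_big /=.
have lb : h%:R * (#|pinned_labels n h|%:R * c / 2) <= \sum_(i : 'I_n | (i < h)%N) \sum_(z in pinned_labels n h) u i z.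
  rewrite -[X in X%:R * _](card_ord_lt hn) mulr_natl -sumr_const.
  rewrite (eq_bigl (fun i : 'I_n => (i < h)%N)); last by move=> i; rewrite inE.
  by apply: ler_sum => i; exact: ui.
have n0 : 0 <= n%:R^-1 :> R by rewrite invr_ge0.
have := ler_wpM2r n0 lb => l1 l2.
have Zp : 0 < #|pinned_labels n h|%:R :> R by rewrite ltr0n.
rewrite -(ler_pM2l Zp); apply: le_trans l2; apply: le_trans l1.
by rewrite invfM le_eqVlt; apply/orP; left; apply/eqP; ring.
Qed.

(** * Balance of the pinned labels and the bound at fixed [n] *)

Lemma sum_spin_odd (R : realType) (n : nat) :
  \sum_(j < n) spin R (odd j) = - (odd n)%:R.
Proof.
elim: n => [|n IH]; first by rewrite big_ord0 oppr0.
by rewrite big_ord_recr /= IH /spin; case: (odd n) => /=; lra.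
Qed.

Lemma sum_spin_pinned (R : realType) (n h : nat) (z : labels n) : (h <= n)%N ->
  z \in pinned_labels n h -> `|\sum_j spin R (z j)| <= 1 + 2 * h%:R.
Proof.
move=> hn /pinned_labelsP zP.
have -> : \sum_j spin R (z j) = \sum_(j < n) spin R (odd j (+) (odd j (+) z j)).
  by apply: eq_bigr => j _; rewrite addKb.
apply: le_trans (spin_flip_le R (fun j : 'I_n => odd j) (fun j => odd j (+) z j)) _.
apply: lerD.
  by rewrite sum_spin_odd normrN; case: (odd n); rewrite ?normr1 ?normr0.
rewrite ler_wpM2l // -[h in X in _ <= X](card_ord_lt hn) -sum1dep_card natr_sum [leRHS]big_mkcond /=.
apply: ler_sum => j _; case: ltnP => hj; first by case: (_ (+) _).
by rewrite zP // addbb.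
Qed.

Lemma n_plus_minus (R : realType) (n : nat) (z : labels n) :
  (n_plus z)%:R + (n_minus z)%:R = n%:R :> R /\
  (n_plus z)%:R - (n_minus z)%:R = \sum_j spin R (z j).
Proof.
have -> : (n_plus z)%:R = \sum_j (z j)%:R :> R.
  by rewrite /n_plus card_mkset -sum1dep_card natr_sum big_mkcond /=; apply: eq_bigr => j _; case: (z j).
have -> : (n_minus z)%:R = \sum_j (~~ z j)%:R :> R.
  by rewrite /n_minus card_mkset -sum1dep_card natr_sum big_mkcond /=; apply: eq_bigr => j _; case: (z j).
rewrite -big_split -sumrB /=; split; last by apply: eq_bigr => j _; rewrite /spin; case: (z j) => /=; lra.
rewrite (eq_bigr (fun=> 1)); last by move=> j _; case: (z j); rewrite /= ?addr0 ?add0r.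
by rewrite sumr_const card_ord.
Qed.

(** Class sizes are half of [n] plus or minus the spin sum. The bound on [h] is exactly the lower
    class constraint; the upper one is weaker because (beta-1)/beta <= beta-1. *)
Lemma pinned_in_Pn (R : realType) (n h : nat) (beta : R) (z : labels n) : (h <= n)%N ->
  1 < beta -> 1 + 2 * h%:R <= n%:R * ((beta - 1) / beta) ->
  z \in pinned_labels n h -> in_Pn beta z.
Proof.
move=> hn b1 hb zP; have [E1 E2] := @n_plus_minus R n z.
have := le_trans (sum_spin_pinned R hn zP) hb; rewrite -E2 ler_norml => /andP[L1 L2].
have b0 : 0 < beta by lra.
have lo : n%:R / (2 * beta) = (n%:R - n%:R * ((beta - 1) / beta)) / 2 by field; rewrite gt_eqF.
have hi : (n%:R + n%:R * ((beta - 1) / beta)) / 2 <= n%:R * beta / 2.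
  rewrite ler_pM2r ?invr_gt0 //.
  have -> : n%:R + n%:R * ((beta - 1) / beta) = n%:R * (1 + (beta - 1) / beta) by ring.
  rewrite ler_wpM2l // -lerBrDl ler_pdivrMr //; nra.
by rewrite /in_Pn lo; split; apply/andP; split; lra.
Qed.

Lemma minI_attained (R : realType) (n L : nat) (rho : R) (p q : nat -> R) :
  exists S : {set 'I_L}, minI n L rho p q = calI n rho p q S.
Proof.
rewrite /minI; apply: (big_ind (fun x => exists S : {set 'I_L}, x = calI n rho p q S)).
- by exists finset.setT.
- by move=> x y [S ->] [S' ->]; rewrite minEle; case: ifP => _; [exists S|exists S'].
- by move=> S _; exists S.
Qed.

Lemma obs_prob_ge0 (R : realType) (n L : nat) (C rho : R) (p q : nat -> R) z A :
  sparse L C p q -> 0 < rho < 1 -> 0 <= @obs_prob R n L rho p q z A.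
Proof.
move=> sp r01; apply: sumr_ge0 => xi _; rewrite mulr_ge0 //.
  by apply: prodr_ge0 => k _; exact/ltW/(@bernw_gt0 R rho (xi k)).
by apply: adj_prob_ge0 => l /sp[q0 qp p2 _]; split; lra.
Qed.

(** At a minimising [S] each of three errors is at most [e * calI]: the entropy of the flips because
    [Jrho] is large, the edge fluctuations because [kappa] is small, the imbalances because [h / n]
    and [rho] are small. *)
Lemma minimax_risk_lower (R : realType) (n L h : nat) (C rho kappa e beta : R) (p q : nat -> R) :
  1 <= C -> sparse L C p q -> 0 < rho < 1 / 2 -> 0 < kappa -> 1 < beta ->
  (0 < n)%N -> (3 * h <= n)%N -> 1 + 2 * h%:R <= n%:R * ((beta - 1) / beta) ->
  ln 2 <= e * Jrho rho -> kappa * (2 * C + 2) * (8 * C) <= e ->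
  48 * C * (3 + 2 * h%:R + 2 * (n%:R * rho)) <= e * n%:R ->
  h%:R / (2 * n%:R) * expR (- ((1 + 3 * e) * minI n L rho p q + (4 * kappa)^-1))
    <= minimax_risk n L rho p q beta.
Proof.
move=> C1 sp r01 k0 b1 n0 h3 hb eJ ek eh.
have r1 : 0 < rho < 1 by lra.
have hn : (h <= n)%N by lia.
have nR : 0 < n%:R :> R by rewrite ltr0n.
apply: minimax_risk_ge => //.
- by move=> z A; exact: (obs_prob_ge0 _ _ sp).
- by move=> z; exact: pinned_in_Pn.
move=> z i zP; have [S ->] := minI_attained n L rho p q.
apply: le_trans (sum_min_obs_prob_ge S i z sp r01 k0).
rewrite ler_expR lerN2.
have I0 : 0 <= calI n rho p q S by exact: (calI_ge0 _ _ sp).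
have A1 : (evenup #|~: S|)%:R * ln 2 <= e * calI n rho p q S.
  have e0 : 0 <= e by apply: le_trans ek; rewrite !mulr_ge0 //; lra.
  have := ler_wpM2l e0 (calI_ge_noise n S sp r01).
  apply: le_trans; rewrite mulrCA ler_wpM2l //.
have C0 : 0 <= C by lra.
have D := calI_ge_chi2 n S C0 sp r01.
have A2 : kappa * (2 * C + 2) * (n%:R * (\sum_(l in S) chi2 p q l)) <= e * calI n rho p q S.
  apply: (@le_trans _ _ (kappa * (2 * C + 2) * (8 * C * calI n rho p q S))).
    by rewrite ler_wpM2l // mulr_ge0; lra.
  by rewrite mulrA ler_wpM2r.
have A3 : 6 * (\sum_(l in S) chi2 p q l) * (2 + `|\sum_j spin R (z j)| + 2 * (n%:R * rho)) <= e * calI n rho p q S.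
  have s0 : 0 <= \sum_(l in S) chi2 p q l by apply: sumr_ge0 => l _; exact: (chi2_ge0 _ sp).
  have sz := sum_spin_pinned R hn zP.
  apply: (@le_trans _ _ (6 * (\sum_(l in S) chi2 p q l) * (3 + 2 * h%:R + 2 * (n%:R * rho)))).
    by rewrite ler_wpM2l ?mulr_ge0 //; lra.
  rewrite -(ler_pM2l nR).
  have f0 : 0 <= 6 * (3 + 2 * h%:R + 2 * (n%:R * rho)).
    by rewrite mulr_ge0 // !addr_ge0 // !mulr_ge0 //; lra.
  have := ler_wpM2l f0 D; have := ler_wpM2r I0 eh; lra.
lra.
Qed.

Lemma Jrho_ge (R : realType) (rho a : R) : 0 < rho < 1 / 2 -> 4 * rho <= expR (- a) ^+ 2 ->
  a <= Jrho rho.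
Proof.
move=> r01 H; rewrite -lerN2 -ler_expR expR_Jrho //.
have r0 : 0 <= rho * (1 - rho) by rewrite mulr_ge0; lra.
have s0 := sqrtr_ge0 (rho * (1 - rho)).
rewrite -ler_sqr ?nnegrE ?expR_ge0 ?mulr_ge0 // exprMn sqr_sqrtr //.
nra.
Qed.

(** * Asymptotics *)

(** For [beta = 1] both classes must have size n/2, which is impossible for odd [n]. *)
Lemma in_Pn_nonempty_beta (R : realType) (beta : R) : 1 <= beta ->
  (\forall n \near \oo, exists z : labels n, in_Pn beta z) -> 1 < beta.
Proof.
rewrite le_eqVlt => /orP[/eqP <-|//] [N _ H].
have hN : (N <= (2 * N).+1)%N by lia.
have [z [/andP[z1 z2] _]] := H _ hN.
exfalso; have E : (n_plus z * 2)%N = (2 * N).+1.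
  by apply/eqP; rewrite -(eqr_nat R) natrM; apply/eqP; lra.
lia.
Qed.

Lemma minimax_risk_eventually (R : realType) (L : nat -> nat) (rho : nat -> R)
  (p q : nat -> nat -> R) (C beta e : R) :
  (forall n, 0 < rho n < 1 / 2) ->
  rho @ \oo --> (0 : R) ->
  1 <= C ->
  (forall n l, (l < L n)%N -> 0 < q n l /\ q n l < p n l /\ p n l < 1 /\ p n l <= C * q n l) ->
  (fun n => \big[Num.max/0]_(l < L n) p n l) @ \oo --> (0 : R) ->
  1 < beta -> 0 < e ->
  exists c1 : R, 0 < c1 /\ \forall n \near \oo,
    c1 * expR (- ((1 + 3 * e) * minI n (L n) (rho n) (p n) (q n)))
      <= minimax_risk n (L n) (rho n) (p n) (q n) beta.
Proof.
move=> rho01 rho0 C1 pq p0 b1 e0.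
pose theta := (beta - 1) / beta.
have th0 : 0 < theta by rewrite divr_gt0; lra.
(* [eta] is the proportion of free nodes: 1/3 gives [3 * h <= n], [theta / 4] the class constraint,
   and [e / (288 * C)] makes the [h] term in [eh] at most a third of [e * n%:R]. *)
pose eta := Num.min (1 / 3) (Num.min (theta / 4) (e / (288 * C))).
have C0 : 0 < 288 * C by lra.
have eta0 : 0 < eta by rewrite /eta !lt_min; apply/and3P; split; rewrite divr_gt0.
have : eta <= eta by []; rewrite {2}/eta !le_min => /and3P[eta1 eta2 eta3].
have eC : e / (288 * C) * (288 * C) = e by rewrite divfK // gt_eqF.
pose kappa := e / ((2 * C + 2) * (8 * C)).
have kC0 : 0 < (2 * C + 2) * (8 * C) by rewrite mulr_gt0; lra.
have k0 : 0 < kappa by rewrite divr_gt0.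
have rC0 : 0 < e / (288 * C) by rewrite divr_gt0.
have d0 : 0 < expR (- (ln 2 / e)) ^+ 2 / 4 :> R by rewrite divr_gt0 ?exprn_gt0 ?expR_gt0.
have h2 : (0 : R) < 1 / 2 by lra.
(* Once [eta * n%:R >= 2], truncation leaves [h >= eta * n%:R / 2], so [h%:R / (2 * n%:R)] is at
   least [eta / 4]. *)
exists (eta / 4 * expR (- (4 * kappa)^-1)); split; first by rewrite mulr_gt0 ?expR_gt0 ?divr_gt0.
near=> n.
have sp : sparse (L n) C (p n) (q n).
  move=> l lL; have [q0 [qp [_ pC]]] := pq n l lL; split => //.
  apply: (@le_trans _ _ (\big[Num.max/0]_(l < L n) p n l)).
    exact: (@le_bigmax _ _ _ _ (fun l : 'I_(L n) => p n l) (Ordinal lL)).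
  by near: n; exact: (cvgr_le _ p0 _ h2).
have r1 : rho n <= e / (288 * C) by near: n; exact: (cvgr_le _ rho0 _ rC0).
have r2 : rho n <= expR (- (ln 2 / e)) ^+ 2 / 4 by near: n; exact: (cvgr_le _ rho0 _ d0).
have n1 : 2 / eta <= n%:R by near: n; exact: nbhs_infty_ger.
have n2 : 2 / theta <= n%:R by near: n; exact: nbhs_infty_ger.
have n3 : 432 * C / e <= n%:R by near: n; exact: nbhs_infty_ger.
rewrite ler_pdivrMr // in n1; rewrite ler_pdivrMr // in n2; rewrite ler_pdivrMr // in n3.
have nR : 0 < n%:R :> R by rewrite -(pmulr_lgt0 _ eta0); lra.
have n0 : (0 < n)%N by rewrite -(ltr0n R).
pose h := Num.truncn (eta * n%:R).
have /andP[hle hlt] : h%:R <= eta * n%:R < h.+1%:R by apply: truncn_itv; rewrite ltW ?mulr_gt0.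
rewrite -natr1 in hlt.
have h3 : (3 * h <= n)%N by rewrite -(ler_nat R) natrM; nra.
have hth : 1 + 2 * h%:R <= n%:R * theta by nra.
have J1 : ln 2 <= e * Jrho (rho n).
  rewrite mulrC -ler_pdivrMr //; apply: Jrho_ge => //; lra.
have ek : kappa * (2 * C + 2) * (8 * C) <= e.
  by rewrite -mulrA divfK // gt_eqF.
have eh : 48 * C * (3 + 2 * h%:R + 2 * (n%:R * rho n)) <= e * n%:R.
  have A1 : C * h%:R <= C * (e / (288 * C) * n%:R) by rewrite ler_wpM2l //; nra.
  have A2 : C * (n%:R * rho n) <= C * (n%:R * (e / (288 * C))) by rewrite !ler_wpM2l //; lra.
  have E1 : C * (e / (288 * C) * n%:R) = e * n%:R / 288 by rewrite -{2}eC; field; lra.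
  have E2 : C * (n%:R * (e / (288 * C))) = e * n%:R / 288 by rewrite -{2}eC; field; lra.
  rewrite E1 in A1; rewrite E2 in A2; lra.
apply: le_trans (minimax_risk_lower C1 sp (rho01 n) k0 b1 n0 h3 hth J1 ek eh).
rewrite opprD expRD -[leLHS]mulrA [X in _ * X <= _]mulrC.
apply: ler_wpM2r; first by rewrite mulr_ge0 ?expR_ge0.
by rewrite ler_pdivlMr ?mulr_gt0 //; lra.
Unshelve. all: by end_near. Qed.

Theorem mainTheorem1 (R : realType) (L : nat -> nat) (rho : nat -> R)
  (p q : nat -> nat -> R) (C c C0 beta : R) :
  (forall n, 0 < rho n < 1 / 2) ->
  rho @ \oo --> (0 : R) ->
  (forall n, (1 <= L n)%N) ->
  1 <= C ->
  (forall n l, (l < L n)%N -> 0 < q n l /\ q n l < p n l /\ p n l < 1 /\ p n l <= C * q n l) ->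
  (fun n => \big[Num.max/0]_(l < L n) p n l) @ \oo --> (0 : R) ->
  0 <= c -> 0 < C0 ->
  (forall n, (0 < n)%N -> (L n)%:R <= C0 * n%:R `^ c) ->
  1 <= beta ->
  (\forall n \near \oo, exists z : labels n, in_Pn beta z) ->
  ((fun n => minI n (L n) (rho n) (p n) (q n) : R) @ \oo --> +oo ->
     exists delta : nat -> R, delta @ \oo --> (0 : R) /\
       \forall n \near \oo,
         expR (- (1 + delta n) * minI n (L n) (rho n) (p n) (q n))
           <= minimax_risk n (L n) (rho n) (p n) (q n) beta)
  /\
  ((exists M : R, \forall n \near \oo, minI n (L n) (rho n) (p n) (q n) <= M) ->
     exists c' : R, 0 < c' /\
       \forall n \near \oo, c' <= minimax_risk n (L n) (rho n) (p n) (q n) beta).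
Proof.
move=> rho01 rho0 _ C1 pq p0 _ _ _ beta1 nonempty.
have b1 := in_Pn_nonempty_beta beta1 nonempty.
have lower e (e0 : 0 < e) := minimax_risk_eventually rho01 rho0 C1 pq p0 b1 e0.
set mI := fun n => minI n (L n) (rho n) (p n) (q n).
set mm := fun n => minimax_risk n (L n) (rho n) (p n) (q n) beta.
split.
  (* The least nonnegative [delta] for which the bound holds; the work is in showing that it
     vanishes. *)
  move=> Ioo; exists (fun n => Num.max 0 (- ln (mm n) / mI n - 1)); split; last first.
    have [c1 [c10 c1n]] := lower 1 ltr01.
    near=> n.
    have I1 : 1 <= mI n by near: n; move/cvgryPge: Ioo; exact.
    have I0 : 0 < mI n by lra.
    have m0 : 0 < mm n.
      by apply: lt_le_trans (_ : c1 * expR (- ((1 + 3 * 1) * mI n)) <= _);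
        [rewrite mulr_gt0 ?expR_gt0|near: n].
    rewrite -/(mm n) -[leRHS](lnK m0) ler_expR mulNr lerNl -ler_pdivrMr // -lerBlDl.
    by rewrite le_max lexx orbT.
  apply/cvgrPdist_le => /= e e0.
  (* Half of [e] is spent on [3 * (e / 6)], the other half absorbs [- ln c1] once [mI n] is
     large. *)
  have e6 : 0 < e / 6 by rewrite divr_gt0.
  have [c1 [c10 c1n]] := lower (e / 6) e6.
  near=> n.
  have I1 : Num.max 1 (- ln c1 / (e / 2)) <= mI n by near: n; move/cvgryPge: Ioo; exact.
  move: I1; rewrite ge_max => /andP[I1 I2].
  have I0 : 0 < mI n by lra.
  have mlow : c1 * expR (- ((1 + 3 * (e / 6)) * mI n)) <= mm n by near: n.
  have m0 : 0 < mm n by apply: lt_le_trans mlow; rewrite mulr_gt0 ?expR_gt0.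
  rewrite sub0r normrN ger0_norm ?le_max ?lexx // ge_max (ltW e0) /= lerBlDr ler_pdivrMr //.
  have : ln (c1 * expR (- ((1 + 3 * (e / 6)) * mI n))) <= ln (mm n).
    by rewrite ler_ln ?posrE // mulr_gt0 ?expR_gt0.
  rewrite lnM ?posrE ?expR_gt0 // expRK.
  by rewrite ler_pdivrMr ?divr_gt0 // in I2; lra.
move=> [M IM].
(* Any fixed accuracy works for bounded [mI]; 1/3 gives the exponent factor
   [1 + 3 * (1 / 3) = 2]. *)
have e3 : (0 : R) < 1 / 3 by lra.
have [c1 [c10 c1n]] := lower (1 / 3) e3.
exists (c1 * expR (- (2 * M))); split; first by rewrite mulr_gt0 ?expR_gt0.
near=> n.
have m1 : mI n <= M by near: n.
apply: le_trans (_ : c1 * expR (- ((1 + 3 * (1 / 3)) * mI n)) <= _); last by near: n.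
by rewrite ler_pM2l // ler_expR; lra.
Unshelve. all: by end_near. Qed.
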